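(* Let $M$ be an arbitrary convex set of equivalent measures on $(\Omega,\mathcal F)$. Suppose that a super-martingale $\{f_m,\mathcal F_m\}_{m=0}^\infty$ relative to $M$ satisfies $$|f_m|\le C\xi_0,\qquad m\ge1,$$ for some $\xi_0\in A_0$ and some constant $0<C<\infty$. Then $\{f_m,\mathcal F_m\}_{m=0}^\infty$ is local regular if and only if it belongs to the set $K$ (defined in the context).
   Context: Let $(\Omega,\mathcal F)$ be a measurable space with a filtration $\mathcal F_0\subset\mathcal F_1\subset\dots\subset\mathcal F$, where $\mathcal F_0=\{\emptyset,\Omega\}$ and $\mathcal F=\sigma(\bigcup_{n\ge1}\mathcal F_n)$. ''Convex set of equivalent measures'' means a convex set $M$ of pairwise equivalent probability measures on $\mathcal F$. Standing assumption: for all $P,Q\in M$ the density $\frac{dP}{dQ}$ is $\mathcal F_1$-measurable and $P_0\left(\frac{dP}{dQ}>0\right)=1$, where $P_0\in M$ is a fixed measure. Super-martingale relative to $M$: an adapted process $\{f_m\}_{m=0}^\infty$ with $E^P|f_m|<\infty$ for all $m\ge1$, $P\in M$, and $E^P\{f_m|\mathcal F_k\}\le f_k$ for all $0\le k\le m$, $P\in M$. A super-martingale relative to $M$ is local regular if $\sup_{P\in M}E^P|f_m|<\infty$ for all $m\ge1$ and there is an adapted nonnegative increasing (non-decreasing in $m$) process $\{g_m,\mathcal F_m\}_{m=0}^\infty$, $g_0=0$, $\sup_{P\in M}E^P|g_m|<\infty$ for $m\ge1$, such that $\{f_m+g_m,\mathcal F_m\}_{m=0}^\infty$ is a martingale relative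 to every measure from $M$. $A_0$ is the set of all nonnegative random variables $\xi$, integrable relative to $M$, with $E^P\xi=1$ for all $P\in M$. For $\xi\in A_0$ the process $\{E^P\{\xi|\mathcal F_m\}\}_{m\ge0}$ does not depend on the choice of $P\in M$. $F_0$ is the set of adapted processes $\{f_m\}_{m=0}^\infty$ with $P(|f_m|<\infty)=1$ for all $P\in M$ and $f_m\le f_{m-1}$ for $m\ge1$. For $\xi\in A_0$, $$L_\xi=\big\{\{f_mE^P\{\xi|\mathcal F_m\}\}_{m=0}^\infty:\ \{f_m\}_{m=0}^\infty\in F_0,\ E^P\xi|f_m|<\infty,\ P\in M\big\},$$ $V=\bigcup_{\xi\in A_0}L_\xi$, and $$K=\Big\{\sum_{i=1}^mC_i\bar f_i:\ \bar f_i\in V,\ C_i\ge0,\ i=1,\dots,m,\ m=1,2,\dots\Big\}.$$ *)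

(* Defs.v *)
From HB Require Import structures.
From mathcomp Require Import all_boot all_order all_algebra.
From mathcomp Require Import all_classical all_reals all_analysis.
From mathcomp Require Import measurable_realfun.

Set Implicit Arguments.
Unset Strict Implicit.
Unset Printing Implicit Defensive.

Import Order.TTheory GRing.Theory Num.Theory.
Import numFieldNormedType.Exports.

Local Open Scope classical_set_scope.
Local Open Scope ring_scope.
Local Open Scope ereal_scope.
Local Open Scope charge_scope.

(* Random variables are real-valued functions, except for the processes in
   [classF0], whose almost sure finiteness is part of the definition.  All
   relations between random variables are understood almost surely; since
   the measures of M are pairwise equivalent, this does not depend on the
   measure of M. *)

Section Setting.
Context {d : measure_display} {T : measurableType d} {R : realType}.

(* X is measurable with respect to the sub-sigma-algebra G of T:
   [g_sigma_algebraType G] is T equipped with the sigma-algebra <<s G>>,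
   which is G itself when G is a sigma-algebra. *)
Definition sub_measurable {d'} {U : measurableType d'} (G : set (set T))
    (X : T -> U) : Prop :=
  measurable_fun [set: g_sigma_algebraType G] (X : g_sigma_algebraType G -> U).

Definition is_filtration (F : nat -> set (set T)) : Prop :=
  [/\ forall n, sigma_algebra [set: T] (F n),
      forall n, F n `<=` F n.+1,
      F 0%N = [set set0; [set: T]] &
      @measurable d T = <<s \bigcup_(n in [set n | (1 <= n)%N]) F n >>].

Definition adapted {d'} {U : measurableType d'} (F : nat -> set (set T))
    (f : nat -> T -> U) : Prop :=
  forall m, sub_measurable (F m) (f m).

(* A probability is a function on all subsets of T, so that mixtures are
   compared on measurable sets only. *)
Definition convex_measures (M : set (probability T R)) : Prop :=
  forall (P Q : probability T R) (t : R), M P -> M Q -> (0 <= t <= 1)%R ->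
  exists2 S : probability T R, M S &
    forall A, measurable A -> S A = t%:E * P A + (1 - t)%:E * Q A.

Definition pairwise_equivalent (M : set (probability T R)) : Prop :=
  forall P Q : probability T R, M P -> M Q -> P `<< Q /\ Q `<< P.

Definition density (P Q : probability T R) : T -> \bar R :=
  'd (charge_of_finite_measure P) '/d Q.

(* [density P Q] is one particular version of dP/dQ; its measurability with
   respect to F_1 means that some version is F_1-measurable. *)
Definition density_condition (F : nat -> set (set T))
    (M : set (probability T R)) (P0 : probability T R) : Prop :=
  forall P Q : probability T R, M P -> M Q ->
    (exists2 h : T -> R, sub_measurable (F 1%N) h &
       {ae Q, forall w, density P Q w = (h w)%:E}) /\
    P0 [set w | 0 < density P Q w] = 1.

(* Y is a version of E^P{X|G}, for X integrable with respect to P. *)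
Definition is_cond_exp (P : probability T R) (G : set (set T)) (X Y : T -> R)
    : Prop :=
  [/\ sub_measurable G Y,
      P.-integrable [set: T] (EFin \o Y) &
      forall A, G A -> \int[P]_(w in A) (Y w)%:E = \int[P]_(w in A) (X w)%:E].

Definition almost_surely (M : set (probability T R)) (phi : T -> Prop) : Prop :=
  forall P : probability T R, M P -> {ae P, forall w, phi w}.

Definition sup_expectation (M : set (probability T R)) (X : T -> R) : \bar R :=
  ereal_sup [set 'E_P[X] | P in M].

Definition supermartingale (F : nat -> set (set T))
    (M : set (probability T R)) (f : nat -> T -> R) : Prop :=
  [/\ adapted F f,
      forall (P : probability T R) m, M P -> (1 <= m)%N ->
        P.-integrable [set: T] (EFin \o f m) &
      forall (P : probability T R) k m, M P -> (k <= m)%N ->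
        exists2 Y : T -> R, is_cond_exp P (F k) (f m) Y &
          {ae P, forall w, (Y w <= f k w)%R}].

Definition martingale (F : nat -> set (set T))
    (M : set (probability T R)) (f : nat -> T -> R) : Prop :=
  [/\ adapted F f,
      forall (P : probability T R) m, M P -> (1 <= m)%N ->
        P.-integrable [set: T] (EFin \o f m) &
      forall (P : probability T R) k m, M P -> (k <= m)%N ->
        exists2 Y : T -> R, is_cond_exp P (F k) (f m) Y &
          {ae P, forall w, Y w = f k w}].

Definition local_regular (F : nat -> set (set T))
    (M : set (probability T R)) (f : nat -> T -> R) : Prop :=
  [/\ supermartingale F M f,
      forall m, (1 <= m)%N ->
        sup_expectation M (fun w => `|f m w|%R) < +oo &
      exists g : nat -> T -> R,
        [/\ adapted F g,
            forall m, almost_surely M (fun w => (0 <= g m w)%R),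
            forall m, almost_surely M (fun w => (g m w <= g m.+1 w)%R),
            almost_surely M (fun w => g 0%N w = 0%R) &
            (forall m, (1 <= m)%N ->
              sup_expectation M (fun w => `|g m w|%R) < +oo) /\
            martingale F M (fun m w => (f m w + g m w)%R)]].

Definition classA0 (M : set (probability T R)) : set (T -> R) :=
  [set xi : T -> R | [/\ measurable_fun [set: T] xi,
      almost_surely M (fun w => (0 <= xi w)%R),
      forall P : probability T R, M P ->
        P.-integrable [set: T] (EFin \o xi) &
      forall P : probability T R, M P -> 'E_P[xi] = 1]].

Definition classF0 (F : nat -> set (set T)) (M : set (probability T R))
    : set (nat -> T -> \bar R) :=
  [set f | [/\ adapted F f,
      forall (P : probability T R) m, M P ->
        P [set w | `|f m w| < +oo] = 1 &
      forall m, (1 <= m)%N -> almost_surely M (fun w => f m w <= f m.-1 w)]].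

Definition classL (F : nat -> set (set T)) (M : set (probability T R))
    (xi : T -> R) : set (nat -> T -> R) :=
  [set fb : nat -> T -> R | adapted F fb /\
    exists f : nat -> T -> \bar R,
    [/\ classF0 F M f,
        forall (P : probability T R) m, M P ->
          \int[P]_w ((xi w)%:E * `|f m w|) < +oo &
        forall (P : probability T R) m, M P ->
          exists2 Y : T -> R, is_cond_exp P (F m) xi Y &
            {ae P, forall w, (fb m w)%:E = f m w * (Y w)%:E}]].

Definition classV (F : nat -> set (set T)) (M : set (probability T R))
    : set (nat -> T -> R) :=
  \bigcup_(xi in classA0 M) classL F M xi.

Definition classK (F : nat -> set (set T)) (M : set (probability T R))
    : set (nat -> T -> R) :=
  [set f | exists (n : nat) (C : 'I_n -> R) (fb : 'I_n -> nat -> T -> R),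
    [/\ (1 <= n)%N, forall i, (0 <= C i)%R, forall i, classV F M (fb i) &
        forall m,
          almost_surely M (fun w => f m w = (\sum_(i < n) C i * fb i m w)%R)]].

End Setting.

(* Main.v *)
Require Import Defs.
From HB Require Import structures.
From mathcomp Require Import all_boot all_order all_algebra.
From mathcomp Require Import all_classical all_reals all_analysis.
From mathcomp Require Import measurable_realfun.
Set Implicit Arguments.
Unset Strict Implicit.
Unset Printing Implicit Defensive.
Import Order.TTheory GRing.Theory Num.Theory.
Import numFieldNormedType.Exports.
Local Open Scope classical_set_scope.
Local Open Scope ring_scope.

(** Write [xi_m] for a version of [E^P(xi | F_m)]; since the densities are
    F_1-measurable, one version serves all [P] in [M].

    If [f = sum_i C_i a_i xi_i] with nonincreasing [a_i], then
    [g_m = sum_i C_i sum_(k < m) (a_i(k) - a_i(k+1)) xi_i(k+1)] is a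
    nondecreasing compensator, and [E^P g_m = f_0 - E^P f_m] is bounded.

    Conversely let [N = f + g] be the martingale and enlarge [C] so that
    [f_0 + C > 0].  The variables [N_m + C xi0] are nonnegative and dominated by
    the integrable [2 C xi0 + sup_m g_m].  Instead of a martingale convergence
    theorem, take the limit of the measures [A |-> int_A (N_m + C xi0) dP0] along
    a nonprincipal ultrafilter: domination makes it countably additive, and its
    Radon-Nikodym density [xs] satisfies [E^P(xs | F_m) = N_m + C xi0_m].  Then
    [f_m = (f_0 + C) (xs / (f_0 + C))_m + C (-1) xi0_m + (- g_m)] is in [K]. *)

(** * Integrals against weights measurable for a sub-sigma-algebra *)

Section WeightedIntegrals.
Context {d : measure_display} {T : measurableType d} {R : realType}.
Variable G : set (set T).
Hypothesis GT : <<s G >> `<=` @measurable _ T.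
Local Open Scope ereal_scope.
Import HBNNSimple.

Lemma sub_measurableW {d'} {U : measurableType d'} (X : T -> U) :
  sub_measurable G X -> measurable_fun [set: T] X.
Proof.
move=> mX _ B mB; apply: GT.
by have := mX measurableT B mB.
Qed.

(** The equality passes from sets of [<<s G>>] to simple weights by linearity, and to [Z] by
    monotone convergence. Two measures are allowed so that the same statement serves to take known
    factors out of a conditional expectation and to change the measure. *)
Lemma weighted_integral_eq (mu nu : {measure set T -> \bar R}) (u v Z : T -> R) :
  measurable_fun [set: T] u -> measurable_fun [set: T] v ->
  (forall w, (0 <= u w)%R) -> (forall w, (0 <= v w)%R) ->
  (forall A, <<s G >> A ->
    \int[mu]_(w in A) (u w)%:E = \int[nu]_(w in A) (v w)%:E) ->
  sub_measurable G Z -> (forall w, (0 <= Z w)%R) ->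
  forall A, <<s G >> A ->
    \int[mu]_(w in A) (Z w * u w)%:E = \int[nu]_(w in A) (Z w * v w)%:E.
Proof.
move=> mu_ mv_ u0 v0 uv mZ Z0 A GA.
have mA := GT GA.
have mEZ : measurable_fun [set: g_sigma_algebraType G]
    (EFin \o (Z : g_sigma_algebraType G -> R)) by exact/measurable_EFinP.
(* The approximation is carried out in the type equipped with [<<s G>>], so that the level sets of
   [h n] lie in [<<s G>>]. *)
pose h := nnsfun_approx (measurableT : measurable [set: g_sigma_algebraType G]) mEZ.
have mh n B : measurable B -> <<s G >> (h n @^-1` B).
  by move=> mB; have := @measurable_funP _ _ _ _ setT (h n) measurableT B mB; rewrite setTI.
have mhT n : measurable_fun [set: T] (h n : T -> R).
  by apply: sub_measurableW; exact: measurable_funP.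
have approx (rho : {measure set T -> \bar R}) (f : T -> R) :
    measurable_fun [set: T] f -> (forall w, (0 <= f w)%R) ->
    (fun n => \int[rho]_(w in A) (h n w * f w)%:E) @ \oo -->
    \int[rho]_(w in A) (Z w * f w)%:E.
  move=> mf f0.
  have -> : \int[rho]_(w in A) (Z w * f w)%:E =
      \int[rho]_(w in A) limn (fun n => (h n w * f w)%:E).
    apply: eq_integral => w _; apply/esym/cvg_lim => //.
    under eq_fun do rewrite EFinM.
    rewrite EFinM; apply: cvgeZr => //.
    by apply: cvg_nnsfun_approx => // x _; rewrite lee_fin.
  apply: cvg_monotone_convergence => //.
  - move=> n; apply/measurable_EFinP/measurable_funTS.
    by apply: measurable_funM.
  - by move=> n w _; rewrite lee_fin mulr_ge0.
  - move=> w _ m n mn; rewrite lee_fin ler_wpM2r//.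
    have /lefP := @nd_nnsfun_approx _ _ _ _
      (measurableT : measurable [set: g_sigma_algebraType G]) _ mEZ m n mn.
    exact.
have simple (rho : {measure set T -> \bar R}) (f : T -> R) n :
    measurable_fun [set: T] f -> (forall w, (0 <= f w)%R) ->
    \int[rho]_(w in A) (h n w * f w)%:E =
    \sum_(y \in range (h n)) (y%:E * \int[rho]_(w in A `&` h n @^-1` [set y]) (f w)%:E).
  move=> mf f0.
  have -> : \int[rho]_(w in A) (h n w * f w)%:E =
     \int[rho]_(w in A) (\sum_(y \in range (h n)) (y%:E * ((EFin \o f) \_ (h n @^-1` [set y])) w)).
    apply: eq_integral => w _.
    rewrite (fimfunE (h n)) EFinM -fsumEFin//.
    rewrite ge0_mule_fsuml; last first.
      move=> y; rewrite lee_fin indicE.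
      by case: (boolP (w \in _)) => [/[!inE]/= <-|_]; rewrite ?mulr1 ?mulr0.
    apply: eq_fsbigr => y _; rewrite patchE indicE /=.
    by case: ifPn => _; rewrite ?mulr1 ?mulr0 ?mul0e ?mule0.
  rewrite ge0_integral_fsum//; last 2 first.
  - move=> y; apply: measurable_funTS; apply: emeasurable_funM => //.
    apply/(measurable_restrictT _ _).1 => //; first by apply: GT; exact: mh.
    exact/measurable_funTS/measurable_EFinP.
  - move=> y w _; rewrite patchE; case: ifPn => [/[!inE]/= <-|]; rewrite ?mule0//.
    by rewrite -EFinM lee_fin mulr_ge0.
  apply: eq_fsbigr => y /[!inE] -[x _ <-].
  rewrite ge0_integralZl//.
  - by rewrite integral_mkcondr.
  - apply/measurable_funTS/(measurable_restrictT _ _).1 => //; first by apply: GT; exact: mh.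
    exact/measurable_funTS/measurable_EFinP.
  - by move=> w _; rewrite patchE; case: ifPn => // _; rewrite lee_fin.
  - by rewrite lee_fin.
(* [A] intersected with a level set of [h n] is again in [<<s G>>], so [uv] turns each term for [mu]
   into the one for [nu], and the two sequences of integrals coincide. *)
have := approx mu u mu_ u0.
under eq_fun => n.
  rewrite simple//.
  under eq_fsbigr => y yh.
    rewrite uv; last first.
      exact: (@measurableI _ (g_sigma_algebraType G) _ _ GA (mh n _ _)).
    over.
  rewrite -simple//.
  over.
move=> cu; have cv := approx nu v mv_ v0.
exact: cvg_unique cu cv.
Qed.

End WeightedIntegrals.

(** * Restriction of measures to a sub-sigma-algebra and existence of conditional expectations *)

Section RestrictionToSubAlgebra.
Context {d : measure_display} {T : measurableType d} {R : realType}.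
Variables (G : set (set T)) (GT : <<s G >> `<=` @measurable _ T).
Local Open Scope ereal_scope.

(** The image of [P] under the identity map into the coarser space. The inclusion is an argument so
    that the measure instances, whose proofs rest on it, can be attached to the term. *)
Definition restricted_measure & <<s G >> `<=` @measurable _ T :=
  fun (P : probability T R) (A : set (g_sigma_algebraType G)) => P A.

Section Measure.
Variable P : probability T R.
Local Notation mu := (restricted_measure GT P).

Let mu0 : mu set0 = 0. Proof. exact: measure0. Qed.

Let mu_ge0 A : 0 <= mu A. Proof. exact: (measure_ge0 P). Qed.

Let mu_sigma_additive : semi_sigma_additive mu.
Proof.
move=> A mA tA mUA; apply: measure_semi_sigma_additive => //; last exact: GT mUA.
by move=> n; exact: GT (mA n).
Qed.

HB.instance Definition _ := isMeasure.Build _ _ _ mu mu0 mu_ge0 mu_sigma_additive.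

Let muT : mu [set: g_sigma_algebraType G] = 1.
Proof. exact: probability_setT. Qed.

HB.instance Definition _ := Measure_isProbability.Build _ _ _ mu muT.

End Measure.

Definition restricted_charge & <<s G >> `<=` @measurable _ T :=
  fun (nu : {charge set T -> \bar R}) (A : set (g_sigma_algebraType G)) => nu A.

Section Charge.
Variable nu : {charge set T -> \bar R}.
Local Notation rho := (restricted_charge GT nu).

Let rho0 : rho set0 = 0. Proof. exact: charge0. Qed.

Let rho_finite A : measurable A -> rho A \is a fin_num.
Proof. by move=> mA; apply: fin_num_measure; exact: GT mA. Qed.

Let rho_sigma_additive : semi_sigma_additive rho.
Proof.
move=> A mA tA mUA; apply: charge_semi_sigma_additive => //; last exact: GT mUA.
by move=> n; exact: GT (mA n).
Qed.

HB.instance Definition _ := isCharge.Build _ _ _ rho rho0 rho_finite rho_sigma_additive.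

End Charge.

Let measurable_id_sub : measurable_fun [set: T] (id : T -> g_sigma_algebraType G).
Proof. by move=> _ A mA; rewrite setTI; exact: GT mA. Qed.

Lemma integrable_restricted (P : probability T R) (f : T -> \bar R) :
  (restricted_measure GT P).-integrable [set: g_sigma_algebraType G] f ->
  P.-integrable [set: T] f.
Proof.
move=> /integrableP[mf fi]; apply/integrableP; split.
  exact: (sub_measurableW GT mf).
move: fi; rewrite (ge0_integral_pushforward measurable_id_sub P measurableT) //.
exact: measurableT_comp.
Qed.

Lemma integral_restricted (P : probability T R) (f : T -> \bar R) (A : set T) :
  (restricted_measure GT P).-integrable [set: g_sigma_algebraType G] f ->
  <<s G >> A ->
  \int[restricted_measure GT P]_(w in A) f w = \int[P]_(w in A) f w.
Proof.
move=> fi GA; apply: (integral_pushforward measurable_id_sub (mu := P)) => //.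
  exact: measurable_int fi.
apply: integrableS (integrable_restricted fi) => //.
exact: GT.
Qed.

(** The charge [A |-> int_A X dP], restricted to [<<s G>>], is absolutely continuous with respect to
    the restricted [P]; its Radon-Nikodym derivative is the conditional expectation. *)
Lemma cond_exp_exists (P : probability T R) (X : T -> R) :
  sigma_algebra [set: T] G -> P.-integrable [set: T] (EFin \o X) ->
  exists Y, is_cond_exp P G X Y.
Proof.
move=> sG Xi.
pose nu : {charge set _ -> \bar R} := restricted_charge GT (induced_charge Xi).
pose mu : probability (g_sigma_algebraType G) R := restricted_measure GT P.
have numu : nu `<< mu.
  apply/null_content_dominatesP => A mA PA; apply: null_set_integral => //.
  - exact: GT mA.
  - by apply: measurable_funTS; exact: (measurable_int _ Xi).
have Yi := Radon_Nikodym_integrable numu.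
have Yfin w : (EFin \o (fine \o Radon_Nikodym nu mu)) w = Radon_Nikodym nu mu w.
  by rewrite /= fineK// Radon_Nikodym_fin_num.
have YE : EFin \o (fine \o Radon_Nikodym nu mu) = Radon_Nikodym nu mu by exact/funext.
exists (fine \o Radon_Nikodym nu mu); split.
- apply/measurable_EFinP; rewrite YE; exact: measurable_int Yi.
- by rewrite YE; exact: integrable_restricted.
- move=> A GA.
  have sGA : <<s G >> A by exact: sub_sigma_algebra.
  rewrite -[RHS]/(nu A) (Radon_Nikodym_integral numu)// integral_restricted//.
  by apply: eq_integral => w _; exact: Yfin.
Qed.

End RestrictionToSubAlgebra.

(** * Calculus of conditional expectations and change of measure *)

Section ConditionalExpectation.
Context {d : measure_display} {T : measurableType d} {R : realType}.
Variables (G : set (set T)) (sG : sigma_algebra [set: T] G).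
Hypothesis GT : <<s G >> `<=` @measurable _ T.
Implicit Types (P Q : probability T R) (X Y Z : T -> R).
Local Open Scope ereal_scope.

Let G_measurable A : G A -> measurable A.
Proof. by move=> GA; apply: GT; exact: sub_sigma_algebra. Qed.

Let GTT : G [set: T].
Proof.
rewrite -(sigma_algebra_id sG).
exact: (@measurableT _ (g_sigma_algebraType G)).
Qed.

Lemma measurable_pos (U : measurableType d) (X : U -> R) :
  measurable_fun [set: U] X -> measurable_fun [set: U] (fun w => Num.max (X w) 0%R).
Proof. by move=> mX; exact: measurable_maxr. Qed.

Lemma sub_measurable_pos X : sub_measurable G X ->
  sub_measurable G (fun w => Num.max (X w) 0%R).
Proof. by move=> mX; apply: measurable_maxr. Qed.

Lemma ae_integral_eq P X Y A : measurable A ->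
  measurable_fun [set: T] X -> measurable_fun [set: T] Y ->
  {ae P, forall w, X w = Y w} ->
  \int[P]_(w in A) (X w)%:E = \int[P]_(w in A) (Y w)%:E.
Proof.
move=> mA mX mY XY; apply: ae_eq_integral => //.
- exact/measurable_funTS/measurable_EFinP.
- exact/measurable_funTS/measurable_EFinP.
- by apply: filterS XY => w XYw _; rewrite XYw.
Qed.

Lemma ae_integrable_eq P X Y :
  measurable_fun [set: T] Y -> {ae P, forall w, X w = Y w} ->
  P.-integrable [set: T] (EFin \o X) -> P.-integrable [set: T] (EFin \o Y).
Proof.
move=> mY XY /integrableP[mX Xi]; apply/integrableP; split; first exact/measurable_EFinP.
move: Xi; congr (_ < _); apply: ae_eq_integral => //.
- exact: measurableT_comp.
- by apply: measurableT_comp => //; exact/measurable_EFinP.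
- by apply: filterS XY => w XYw _ /=; rewrite XYw.
Qed.

Lemma ae_pos P X : {ae P, forall w, (0 <= X w)%R} ->
  {ae P, forall w, X w = Num.max (X w) 0%R}.
Proof. by apply: filterS => w X0; rewrite max_l. Qed.

Lemma integrable_measurable P X : P.-integrable [set: T] (EFin \o X) ->
  measurable_fun [set: T] X.
Proof. by move=> /measurable_int/measurable_EFinP. Qed.

Lemma cond_exp_measurable P X Y : is_cond_exp P G X Y -> measurable_fun [set: T] Y.
Proof. by move=> [mY _ _]; exact: (sub_measurableW GT mY). Qed.

Lemma cond_exp_ae_eql P X X' Y :
  measurable_fun [set: T] X -> measurable_fun [set: T] X' ->
  {ae P, forall w, X w = X' w} -> is_cond_exp P G X Y -> is_cond_exp P G X' Y.
Proof.
move=> mX mX' XX' [mY Yi YX]; split => // A GA.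
by rewrite YX//; apply: ae_integral_eq => //; exact: G_measurable.
Qed.

Lemma cond_exp_ae_eqr P X Y Y' : sub_measurable G Y' ->
  {ae P, forall w, Y w = Y' w} -> is_cond_exp P G X Y -> is_cond_exp P G X Y'.
Proof.
move=> mY' YY' ceY; have [mY Yi YX] := ceY; split => //.
- by apply: ae_integrable_eq YY' Yi; exact: (sub_measurableW GT mY').
- move=> A GA; rewrite -YX//; apply/esym/ae_integral_eq => //.
  + exact: G_measurable.
  + exact: (sub_measurableW GT mY).
  + exact: (sub_measurableW GT mY').
Qed.

Lemma cond_exp_self P X : sub_measurable G X ->
  P.-integrable [set: T] (EFin \o X) -> is_cond_exp P G X X.
Proof. by []. Qed.

Lemma cond_exp_add P X X' Y Y' :
  P.-integrable [set: T] (EFin \o X) -> P.-integrable [set: T] (EFin \o X') ->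
  is_cond_exp P G X Y -> is_cond_exp P G X' Y' ->
  is_cond_exp P G (fun w => (X w + X' w)%R) (fun w => (Y w + Y' w)%R).
Proof.
move=> Xi Xi' [mY Yi YX] [mY' Yi' YX']; split.
- exact: measurable_funD.
- exact: (integrableD measurableT Yi Yi').
- move=> A GA; have mA := G_measurable GA.
  have iA Z : P.-integrable [set: T] (EFin \o Z) -> P.-integrable A (EFin \o Z).
    by move=> Zi; apply: integrableS Zi.
  by rewrite !integralD_EFin ?YX ?YX'//; exact: iA.
Qed.

Lemma cond_exp_scale P c X Y :
  P.-integrable [set: T] (EFin \o X) ->
  is_cond_exp P G X Y ->
  is_cond_exp P G (fun w => (c * X w)%R) (fun w => (c * Y w)%R).
Proof.
move=> Xi [mY Yi YX]; split.
- exact: measurable_funM.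
- exact: (integrableZl measurableT c Yi).
- move=> A GA; have mA := G_measurable GA.
  have iA Z : P.-integrable [set: T] (EFin \o Z) -> P.-integrable A (EFin \o Z).
    by move=> Zi; apply: integrableS Zi.
  under eq_integral do rewrite EFinM.
  under [RHS]eq_integral do rewrite EFinM.
  rewrite (integralZl mA (iA _ Yi)) (integralZl mA (iA _ Xi)).
  by congr (_ * _); exact: YX.
Qed.

(** The negative part of [Y] has integral at most 0 over the set where [Y] is negative, so it
    vanishes almost everywhere there. Testing this single set serves both conditional expectations,
    where it lies in [G], and the density of the weak limit below. *)
Lemma ge0_integral_ae_ge0 P Y : P.-integrable [set: T] (EFin \o Y) ->
  0 <= \int[P]_(w in [set w | (Y w < 0)%R]) (Y w)%:E ->
  {ae P, forall w, (0 <= Y w)%R}.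
Proof.
move=> Yi; set N := [set w | (Y w < 0)%R] => intN.
have mY := integrable_measurable Yi.
have mN : measurable N.
  have := mY measurableT `]-oo, 0%R[%classic (measurable_itv _).
  rewrite setTI (_ : Y @^-1` _ = N); first by [].
  by apply/seteqP; split => w /=; rewrite in_itv.
have intN0 : \int[P]_(w in N) (Num.max (- Y w) 0%R)%:E = 0.
  apply/eqP; rewrite eq_le; apply/andP; split; last first.
    by apply: integral_ge0 => w _; rewrite lee_fin le_max lexx orbT.
  have -> : \int[P]_(w in N) (Num.max (- Y w) 0%R)%:E = - \int[P]_(w in N) (Y w)%:E.
    rewrite -integralN; last first.
      by apply: integrable_add_def => //; apply: integrableS Yi.
    apply: eq_integral => w /[!inE] Nw; rewrite max_l//.
    by rewrite oppr_ge0 ltW.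
  by rewrite leeNl oppe0.
pose g := EFin \o (fun w => Num.max (- Y w)%R 0%R).
have mg : measurable_fun N g.
  by apply/measurable_EFinP/measurable_funTS/measurable_pos; exact: measurable_funN.
have [/(_ _) aeN _] := ae_eq_integral_abs P mN mg.
have {aeN} : ae_eq P N g (cst 0).
  apply: aeN; rewrite -[RHS]intN0; apply: eq_integral => w _.
  by rewrite gee0_abs// lee_fin le_max lexx orbT.
apply: filterS => w; rewrite leNgt => gN; apply/negP => Yw.
have := gN Yw; rewrite /g/= => -[]; apply/eqP; rewrite gt_eqF//.
by rewrite lt_max oppr_gt0 Yw.
Qed.

Lemma cond_exp_ge0 P X Y :
  measurable_fun [set: T] X -> {ae P, forall w, (0 <= X w)%R} ->
  is_cond_exp P G X Y -> {ae P, forall w, (0 <= Y w)%R}.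
Proof.
move=> mX X0 [mY Yi YX]; apply: ge0_integral_ae_ge0 => //.
set N := [set w | _].
have GN : G N.
  have := mY measurableT `]-oo, 0%R[%classic (measurable_itv _).
  rewrite setTI (_ : _ @^-1` _ = N).
    by rewrite -[X in _ -> X N](sigma_algebra_id sG).
  by apply/seteqP; split => w /=; rewrite in_itv.
rewrite YX// (ae_integral_eq (G_measurable GN) mX (measurable_pos mX) (ae_pos X0)).
by apply: integral_ge0 => w _; rewrite lee_fin le_max lexx orbT.
Qed.

(** [X] and [Y] are nonnegative only almost surely, so their positive parts stand in for them. Both
    sides may be infinite, which allows integrability to be carried from one to the other. *)
Lemma cond_exp_ge0_weight P X Y Z :
  measurable_fun [set: T] X -> {ae P, forall w, (0 <= X w)%R} ->
  is_cond_exp P G X Y ->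
  sub_measurable G Z -> (forall w, (0 <= Z w)%R) ->
  forall A, G A ->
  \int[P]_(w in A) (Z w * X w)%:E = \int[P]_(w in A) (Z w * Y w)%:E.
Proof.
move=> mX X0 ceY mZ Z0 A GA.
have mA := G_measurable GA.
have Y0 := cond_exp_ge0 mX X0 ceY.
have mYT := cond_exp_measurable ceY.
have mZT := sub_measurableW GT mZ.
have [_ _ YX] := ceY.
have mpX := measurable_pos mX.
have mpY := measurable_pos mYT.
rewrite (@ae_integral_eq P _ (fun w => Z w * Num.max (X w) 0)%R)//; last 3 first.
- exact: measurable_funM.
- exact: measurable_funM.
- by apply: filterS (ae_pos X0) => w <-.
rewrite [RHS](@ae_integral_eq P _ (fun w => Z w * Num.max (Y w) 0)%R)//; last 3 first.
- exact: measurable_funM.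
- exact: measurable_funM.
- by apply: filterS (ae_pos Y0) => w <-.
apply: (@weighted_integral_eq _ _ _ G GT) => //.
- by move=> w; rewrite le_max lexx orbT.
- by move=> w; rewrite le_max lexx orbT.
- move=> B; rewrite (sigma_algebra_id sG) => GB.
  have mB := G_measurable GB.
  rewrite -(ae_integral_eq mB mX mpX (ae_pos X0)).
  by rewrite -(ae_integral_eq mB mYT mpY (ae_pos Y0)) YX.
- exact: sub_sigma_algebra.
Qed.

Lemma integrable_weight P X Z : measurable_fun [set: T] X ->
  {ae P, forall w, (0 <= X w)%R} -> measurable_fun [set: T] Z ->
  P.-integrable [set: T] (EFin \o (fun w => Z w * X w)%R) <->
  \int[P]_w (`|Z w| * X w)%:E < +oo.
Proof.
move=> mX X0 mZ.
have mZX : measurable_fun [set: T] (EFin \o (fun w => Z w * X w)%R).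
  by apply/measurable_EFinP; exact: measurable_funM.
have -> : \int[P]_w (`|Z w| * X w)%:E = \int[P]_w `|(EFin \o (fun w => Z w * X w)%R) w|.
  apply: (@ae_integral_eq P _ (fun w => `|Z w * X w|)%R) => //.
  - by apply: measurable_funM => //; exact: measurableT_comp.
  - by apply: measurableT_comp => //; exact: measurable_funM.
  - by apply: filterS X0 => w Xw; rewrite normrM (ger0_norm Xw).
by split=> [/integrableP[]|? ]//; exact/integrableP.
Qed.

(** Integrability of [Z * Y] follows from the nonnegative case applied to the absolute value of [Z];
    the identity follows from the same case for the positive and negative parts of [Z]. *)
Lemma cond_exp_mul P X Y Z :
  measurable_fun [set: T] X -> {ae P, forall w, (0 <= X w)%R} ->
  is_cond_exp P G X Y -> sub_measurable G Z ->
  P.-integrable [set: T] (EFin \o (fun w => Z w * X w)%R) ->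
  is_cond_exp P G (fun w => Z w * X w)%R (fun w => Z w * Y w)%R.
Proof.
move=> mX X0 ceY mZ ZXi.
have Y0 := cond_exp_ge0 mX X0 ceY.
have mYT := cond_exp_measurable ceY.
have mZT := sub_measurableW GT mZ.
have [mY _ _] := ceY.
have ZYi : P.-integrable [set: T] (EFin \o (fun w => Z w * Y w)%R).
  apply/(integrable_weight mYT Y0 mZT).
  move/(integrable_weight mX X0 mZT) : ZXi.
  rewrite (cond_exp_ge0_weight mX X0 ceY)//.
  by apply: measurableT_comp => //; exact: mZ.
split => //; first exact: measurable_funM.
move=> A GA; have mA := G_measurable GA.
have mp := sub_measurable_pos mZ.
have mn : sub_measurable G (fun w => Num.max (- Z w)%R 0%R).
  by apply: sub_measurable_pos; exact: measurable_funN.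
have p0 w : (0 <= Num.max (Z w) 0)%R by rewrite le_max lexx orbT.
have n0 w : (0 <= Num.max (- Z w) 0)%R by rewrite le_max lexx orbT.
have pn w : Z w = (Num.max (Z w) 0 - Num.max (- Z w) 0)%R.
  case/orP: (le_total 0%R (Z w)) => z0.
  - by rewrite max_l// max_r ?oppr_le0// subr0.
  - by rewrite max_r// max_l ?oppr_ge0// sub0r opprK.
have split_int V : measurable_fun [set: T] V ->
    P.-integrable [set: T] (EFin \o (fun w => Z w * V w)%R) ->
    \int[P]_(w in A) (Z w * V w)%:E =
    \int[P]_(w in A) (Num.max (Z w) 0 * V w)%:E - \int[P]_(w in A) (Num.max (- Z w) 0 * V w)%:E.
  move=> mV ZVi; rewrite -integralB_EFin//.
  - by apply: eq_integral => w _; rewrite {1}pn mulrBl EFinB.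
  - apply: (integrableS measurableT) => //; apply: le_integrable ZVi => //.
      apply/measurable_EFinP/measurable_funM => //; exact: (sub_measurableW GT mp).
    move=> w _; rewrite /= lee_fin !normrM ler_wpM2r// ger0_norm//.
    by rewrite ge_max normr_ge0 ler_norm.
  - apply: (integrableS measurableT) => //; apply: le_integrable ZVi => //.
      apply/measurable_EFinP/measurable_funM => //; exact: (sub_measurableW GT mn).
    move=> w _; rewrite /= lee_fin !normrM ler_wpM2r// ger0_norm//.
    by rewrite ge_max normr_ge0 -normrN ler_norm.
by rewrite !split_int// !(cond_exp_ge0_weight mX X0 ceY).
Qed.

Lemma ae_null_dominates P Q (phi : T -> Prop) : Q `<< P ->
  {ae P, forall w, phi w} -> {ae Q, forall w, phi w}.
Proof.
by move=> /null_content_dominatesP QP [N [mN N0 subN]]; exists N; split => //; exact: QP.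
Qed.

Lemma density_change_measure P Q (h : T -> R) X A :
  measurable_fun [set: T] h -> (forall w, (0 <= h w)%R) ->
  (forall B, measurable B -> Q B = \int[P]_(w in B) (h w)%:E) ->
  measurable_fun [set: T] X -> (forall w, (0 <= X w)%R) -> measurable A ->
  \int[Q]_(w in A) (X w)%:E = \int[P]_(w in A) (X w * h w)%:E.
Proof.
move=> mh h0 Qh mX X0 mA.
have mT : @measurable _ T = <<s @measurable _ T >>.
  by rewrite sigma_algebra_id//; exact: sigma_algebra_measurable.
transitivity (\int[Q]_(w in A) (X w * (cst 1 w : R))%:E).
  by apply: eq_integral => w _; rewrite mulr1.
apply: (@weighted_integral_eq _ _ _ (@measurable _ T)) => //.
- by rewrite -mT.
- move=> B; rewrite -mT => mB; rewrite -Qh// -[RHS]mul1e.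
  by rewrite -integral_cst.
- by rewrite /sub_measurable => _ B mB; rewrite /measurable/= -mT; exact: mX.
- by rewrite -mT.
Qed.

(** For [A] in [G], the integrals of [X] and [Y] against [Q] are those of [h * X] and [h * Y]
    against [P]; since [h] is a [G]-measurable weight, they agree even when infinite. Hence
    integrability under [Q] of either variable gives that of the other. *)
Lemma cond_exp_change_measure P Q (h : T -> R) X Y :
  sub_measurable G h -> (forall w, (0 <= h w)%R) ->
  (forall B, measurable B -> Q B = \int[P]_(w in B) (h w)%:E) ->
  measurable_fun [set: T] X -> {ae P, forall w, (0 <= X w)%R} ->
  is_cond_exp P G X Y ->
  Q.-integrable [set: T] (EFin \o X) \/ Q.-integrable [set: T] (EFin \o Y) ->
  is_cond_exp Q G X Y /\ Q.-integrable [set: T] (EFin \o X).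
Proof.
move=> mh h0 Qh mX X0 ceY XYi.
have Y0 := cond_exp_ge0 mX X0 ceY.
have mYT := cond_exp_measurable ceY.
have mhT := sub_measurableW GT mh.
have [mY Yi YX] := ceY.
have QP : Q `<< P.
  apply/null_content_dominatesP => A mA PA; rewrite Qh//; apply: null_set_integral => //.
  exact/measurable_funTS/measurable_EFinP.
have X0Q := ae_null_dominates QP X0; have Y0Q := ae_null_dominates QP Y0.
have toP (V : T -> R) A : measurable A -> measurable_fun [set: T] V ->
    {ae P, forall w, (0 <= V w)%R} ->
    \int[Q]_(w in A) (V w)%:E = \int[P]_(w in A) (h w * V w)%:E.
  move=> mA mV V0; have mpV := measurable_pos mV.
  rewrite (ae_integral_eq mA mV mpV (ae_pos (ae_null_dominates QP V0))).
  rewrite (density_change_measure mhT h0 Qh)//.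
    apply: ae_integral_eq => //.
    - exact: measurable_funM.
    - exact: measurable_funM.
    - by apply: filterS (ae_pos V0) => w <-; rewrite mulrC.
  by move=> w; rewrite le_max lexx orbT.
have YXQ A : G A -> \int[Q]_(w in A) (Y w)%:E = \int[Q]_(w in A) (X w)%:E.
  move=> GA; have mA := G_measurable GA.
  by rewrite !toP// (cond_exp_ge0_weight mX X0 ceY).
have intE (V : T -> R) : measurable_fun [set: T] V -> {ae Q, forall w, (0 <= V w)%R} ->
    Q.-integrable [set: T] (EFin \o V) <-> \int[Q]_w (V w)%:E < +oo.
  move=> mV V0.
  have -> : \int[Q]_w (V w)%:E = \int[Q]_w `|(EFin \o V) w|.
    apply: (@ae_integral_eq Q _ (fun w => `|V w|%R)) => //.
    - exact: measurableT_comp.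
    - by apply: filterS V0 => w Vw; rewrite ger0_norm.
  split=> [/integrableP[]//|?]; apply/integrableP; split => //.
  exact/measurable_EFinP.
have [Xi' Yi'] : Q.-integrable [set: T] (EFin \o X) /\ Q.-integrable [set: T] (EFin \o Y).
  case: XYi => Vi; split => //.
  - by apply/(intE _ mYT Y0Q); rewrite YXQ//; exact/(intE _ mX X0Q).
  - by apply/(intE _ mX X0Q); rewrite -YXQ//; exact/(intE _ mYT Y0Q).
by split.
Qed.

Lemma cond_exp_tower P (G' : set (set T)) X Y Z : G `<=` G' ->
  is_cond_exp P G' X Y -> is_cond_exp P G X Z -> is_cond_exp P G Y Z.
Proof.
move=> GG' [mY Yi YX] [mZ Zi ZX]; split => // A GA.
by rewrite ZX// YX//; exact: GG'.
Qed.

End ConditionalExpectation.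

(** * Consequences of the filtration axioms and of the measurability of densities at time 1 *)

Section Setting.
Context {d : measure_display} {T : measurableType d} {R : realType}.
Variables (F : nat -> set (set T)) (M : set (probability T R)) (P0 : probability T R).
Hypotheses (hF : is_filtration F) (hequiv : pairwise_equivalent M) (hP0 : M P0).
Hypothesis hdens : density_condition F M P0.
Implicit Types (P Q : probability T R) (X Y Z : T -> R).
Local Open Scope ereal_scope.

Lemma filtration_sigma_algebra n : sigma_algebra [set: T] (F n).
Proof. by case: hF. Qed.

Lemma filtration_mono k m : (k <= m)%N -> F k `<=` F m.
Proof.
move=> /subnK <-; elim: (m - k)%N => [//|n IH].
by apply: (subset_trans IH); case: hF => _ + _ _; exact.
Qed.

Lemma filtration_measurable n : <<s F n >> `<=` @measurable _ T.
Proof.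
rewrite sigma_algebra_id; last exact: filtration_sigma_algebra.
case: (hF) => _ _ _ -> A FA; apply: sub_sigma_algebra.
by exists n.+1 => //; exact: filtration_mono FA.
Qed.

Lemma filtration_measurableW n A : F n A -> measurable A.
Proof. by move=> FA; apply: (@filtration_measurable n); exact: sub_sigma_algebra. Qed.

Lemma filtrationT n : F n [set: T].
Proof.
rewrite -(sigma_algebra_id (filtration_sigma_algebra n)).
exact: (@measurableT _ (g_sigma_algebraType (F n))).
Qed.

Lemma sub_measurable_mono {d'} {U : measurableType d'} k m (X : T -> U) :
  (k <= m)%N -> sub_measurable (F k) X -> sub_measurable (F m) X.
Proof.
move=> km mX _ B mB; have := mX measurableT B mB.
rewrite !setTI => kB; apply: sub_sigma_algebra; apply: (filtration_mono km).
by rewrite -(sigma_algebra_id (filtration_sigma_algebra k)).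
Qed.

Lemma sub_measurable_filtration {d'} {U : measurableType d'} m (X : T -> U) :
  sub_measurable (F m) X -> measurable_fun [set: T] X.
Proof. by move=> mX; apply: (sub_measurableW (@filtration_measurable m)). Qed.

(** The preimage of the value at [point] is a nonempty member of [F 0], hence the whole space; the
    equality holds everywhere and not just almost surely. *)
Lemma sub_measurable0_cst X : sub_measurable (F 0%N) X -> X = cst (X point).
Proof.
move=> mX; apply/funext => w.
have := mX measurableT _ (measurable_set1 (X point)).
rewrite setTI => mE; have : F 0%N (X @^-1` [set X point]).
  by rewrite -(sigma_algebra_id (filtration_sigma_algebra 0)).
case: (hF) => _ _ -> _ [|] E.
  have : (X @^-1` [set X point]) point by [].
  by rewrite E.
by have : (X @^-1` [set X point]) w by rewrite E.
Qed.

Lemma probability1_ae P A : measurable A -> P A = 1 -> {ae P, forall w, A w}.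
Proof.
move=> mA PA; exists (~` A); split => //; first exact: measurableC.
by rewrite probability_setC// PA subee.
Qed.

Lemma almost_surelyP0 (phi : T -> Prop) :
  {ae P0, forall w, phi w} -> almost_surely M phi.
Proof.
move=> aphi P MP; apply: ae_null_dominates aphi.
by have [] := hequiv MP hP0.
Qed.

(** The version given by [density_condition] is nonnegative almost surely, because positivity under
    [P0] passes to [P] by equivalence; its positive part is a version that is nonnegative
    everywhere. *)
Lemma density_exists P Q : M P -> M Q -> exists h : T -> R,
  [/\ sub_measurable (F 1%N) h, forall w, (0 <= h w)%R &
      forall B, measurable B -> Q B = \int[P]_(w in B) (h w)%:E].
Proof.
move=> MP MQ; have [[h mh hE] _] := hdens MQ MP.
have QP : Q `<< P by have [] := hequiv MQ MP.
have mhT := sub_measurable_filtration mh.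
have QE B : measurable B -> Q B = \int[P]_(w in B) (h w)%:E.
  move=> mB; rewrite -[LHS]/(charge_of_finite_measure Q B).
  rewrite (Radon_Nikodym_integral (mu := P) (nu := charge_of_finite_measure Q))//.
  apply: ae_eq_integral => //.
  - by apply: measurable_funTS; exact: measurable_int (Radon_Nikodym_integrable _).
  - exact/measurable_funTS/measurable_EFinP.
  - by apply: filterS hE => w hw _.
have h0 : {ae P, forall w, (0 <= h w)%R}.
  have [_ P01] := hdens MQ MP.
  have mdens : measurable_fun [set: T] (density Q P).
    exact: measurable_int (Radon_Nikodym_integrable _).
  have mpos : measurable [set w | 0 < density Q P w].
    by rewrite -[X in measurable X]setTI; exact: emeasurable_fun_o_infty.
  have := almost_surelyP0 (probability1_ae mpos P01) MP.
  by apply: filterS2 hE => w hw /ltW; rewrite hw lee_fin.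
exists (fun w => Num.max (h w) 0%R); split.
- exact: sub_measurable_pos.
- by move=> w; rewrite le_max lexx orbT.
- move=> B mB; rewrite QE//; apply: ae_integral_eq => //.
  + exact: measurable_pos.
  + exact: ae_pos.
Qed.

(** From index 1 on, the density of [Q] with respect to [P] is [F m]-measurable, so
    [cond_exp_change_measure] applies. *)
Lemma cond_exp_equivalent P Q m X Y : M P -> M Q -> (1 <= m)%N ->
  measurable_fun [set: T] X -> almost_surely M (fun w => (0 <= X w)%R) ->
  is_cond_exp P (F m) X Y ->
  Q.-integrable [set: T] (EFin \o X) \/ Q.-integrable [set: T] (EFin \o Y) ->
  is_cond_exp Q (F m) X Y /\ Q.-integrable [set: T] (EFin \o X).
Proof.
move=> MP MQ m1 mX X0 ceY; have [h [mh h0 Qh]] := density_exists MP MQ.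
apply: (cond_exp_change_measure (filtration_sigma_algebra m)
  (@filtration_measurable m) _ h0 Qh mX (X0 _ MP) ceY).
exact: sub_measurable_mono mh.
Qed.

Lemma cond_exp0_cst P X (c : R) : \int[P]_w (X w)%:E = c%:E ->
  is_cond_exp P (F 0%N) X (cst c).
Proof.
move=> Xc; split.
- exact: measurable_cst.
- exact: finite_measure_integrable_cst.
- move=> A; case: (hF) => _ _ -> _ [|] ->; first by rewrite !integral_set0.
  rewrite Xc; transitivity (c%:E * P [set: T]); first by rewrite -integral_cst.
  by rewrite probability_setT mule1.
Qed.

(** At positive indices the measure can be changed. At index 0 the density need not be
    [F 0]-measurable; there the version is constant and equals the expectation 1 common to all
    measures of [M]. *)
Lemma cond_exp_classA0 P xi m Y : M P -> classA0 M xi ->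
  is_cond_exp P0 (F m) xi Y -> is_cond_exp P (F m) xi Y.
Proof.
move=> MP [mxi xi0 xii xi1]; case: m => [|m] ceY; last first.
  by have [] := cond_exp_equivalent hP0 MP (ltn0Sn m) mxi xi0 ceY (or_introl (xii _ MP)).
have [mY Yi YX] := ceY.
have Yc := sub_measurable0_cst mY.
have xiE Q : M Q -> \int[Q]_w (xi w)%:E = 1.
  by move=> MQ; rewrite -(xi1 _ MQ) unlock.
have Y1 : Y point = 1%R.
  have := YX _ (filtrationT 0); rewrite (xiE _ hP0) Yc => YE.
  suff : (Y point)%:E * P0 [set: T] = 1%:E by rewrite probability_setT mule1 => -[].
  by rewrite -integral_cst.
by rewrite Yc Y1; apply: cond_exp0_cst; exact: xiE.
Qed.

(** Induction on [m] by the tower property. Integrability is asked at index 0 as well, since [N 0]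
    must itself be a version of a conditional expectation. *)
Lemma martingale_step (N : nat -> T -> R) : adapted F N ->
  (forall P m, M P -> P.-integrable [set: T] (EFin \o N m)) ->
  (forall P m, M P -> is_cond_exp P (F m) (N m.+1) (N m)) ->
  martingale F M N.
Proof.
move=> aN Ni stepN; split => // [P m MP _|P k m MP km]; first exact: Ni.
exists (N k); last exact/aeW.
elim: m km => [|m IH]; first by rewrite leqn0 => /eqP ->; exact: (cond_exp_self (aN _) (Ni _ _ MP)).
rewrite leq_eqVlt => /predU1P[->|]; first exact: (cond_exp_self (aN _) (Ni _ _ MP)).
rewrite ltnS => km; have [_ _ NE] := IH km; split; [exact: aN|exact: Ni|move=> A FA].
have [_ _ NE'] := stepN P m MP.
by rewrite NE// NE'//; exact: filtration_mono FA.
Qed.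

End Setting.

(** * Processes of [classK] are local regular *)

Section Sufficiency.
Context {d : measure_display} {T : measurableType d} {R : realType}.
Variables (F : nat -> set (set T)) (M : set (probability T R)) (P0 : probability T R).
Hypotheses (hF : is_filtration F) (hequiv : pairwise_equivalent M) (hP0 : M P0).
Hypothesis hdens : density_condition F M P0.
Implicit Types (P Q : probability T R) (X Y Z : T -> R).
Local Open Scope ereal_scope.

(** Adding [g] turns [b] into a martingale under every measure of [M]; the one-step form suffices by
    [martingale_step]. Such pairs are closed under sums and nonnegative multiples, which matches the
    cone structure of [classK]. *)
Definition compensator (b g : nat -> T -> R) : Prop :=
  [/\ adapted F b, adapted F g, forall w, g 0%N w = 0%R,
      forall m, almost_surely M (fun w => (g m w <= g m.+1 w)%R) &
      forall P m, M P -> [/\ P.-integrable [set: T] (EFin \o b m),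
        P.-integrable [set: T] (EFin \o g m) &
        is_cond_exp P (F m) (fun w => b m.+1 w + g m.+1 w)%R
                            (fun w => b m w + g m w)%R]].

Lemma compensator0 : compensator (fun _ => cst 0%R) (fun _ => cst 0%R).
Proof.
split => //.
- by move=> m /=; apply: measurable_cst.
- by move=> m /=; apply: measurable_cst.
- by move=> m P MP; exact: aeW.
- move=> P m MP; split; [exact: integrable0|exact: integrable0|].
  rewrite (_ : (fun w => _) = cst 0%R); last by apply/funext => w; rewrite /= addr0.
  by apply: cond_exp_self; [exact: measurable_cst|exact: integrable0].
Qed.

Lemma compensatorD b b' g g' : compensator b g -> compensator b' g' ->
  compensator (fun m w => b m w + b' m w)%R (fun m w => g m w + g' m w)%R.
Proof.
move=> [ab ag g0 gi ce] [ab' ag' g0' gi' ce']; split.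
- by move=> m; apply: measurable_funD; [exact: ab|exact: ab'].
- by move=> m; apply: measurable_funD; [exact: ag|exact: ag'].
- by move=> w; rewrite g0 g0' addr0.
- by move=> m P MP; apply: filterS2 (gi m P MP) (gi' m P MP) => w; exact: lerD.
- move=> P m MP; have [bi gi_ C] := ce P m MP; have [bi' gi_' C'] := ce' P m MP.
  have [bi1 gi1 _] := ce P m.+1 MP; have [bi1' gi1' _] := ce' P m.+1 MP.
  split; [exact: (integrableD measurableT bi bi')|exact: (integrableD measurableT gi_ gi_')|].
  under [X in is_cond_exp _ _ X _]eq_fun do rewrite addrACA.
  under [X in is_cond_exp _ _ _ X]eq_fun do rewrite addrACA.
  apply: (cond_exp_add (filtration_measurable hF (n := m))) => //.
  + exact: (integrableD measurableT bi1 gi1).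
  + exact: (integrableD measurableT bi1' gi1').
Qed.

Lemma compensatorZ c b g : (0 <= c)%R -> compensator b g ->
  compensator (fun m w => c * b m w)%R (fun m w => c * g m w)%R.
Proof.
move=> c0 [ab ag g0 gi ce]; split.
- by move=> m; apply: measurable_funM => //; exact: ab.
- by move=> m; apply: measurable_funM => //; exact: ag.
- by move=> w; rewrite g0 mulr0.
- by move=> m P MP; apply: filterS (gi m P MP) => w; exact: ler_wpM2l.
- move=> P m MP; have [bi gi_ C] := ce P m MP; have [bi1 gi1 _] := ce P m.+1 MP.
  split; [exact: (integrableZl measurableT c bi)|exact: (integrableZl measurableT c gi_)|].
  under [X in is_cond_exp _ _ X _]eq_fun do rewrite -mulrDr.
  under [X in is_cond_exp _ _ _ X]eq_fun do rewrite -mulrDr.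
  apply: (cond_exp_scale (filtration_measurable hF (n := m))) => //.
  exact: (integrableD measurableT bi1 gi1).
Qed.

Lemma compensator_sum n (C : 'I_n -> R) (fb : 'I_n -> nat -> T -> R) :
  (forall i, (0 <= C i)%R) -> (forall i, exists g, compensator (fb i) g) ->
  exists g, compensator (fun m w => \sum_(i < n) C i * fb i m w)%R g.
Proof.
elim: n C fb => [|n IH] C fb C0 cfb.
  exists (fun _ => cst 0%R).
  rewrite (_ : (fun m w => _) = (fun _ => cst 0%R)); first exact: compensator0.
  by apply/funext => m; apply/funext => w; rewrite big_ord0.
have [g cg] := IH (fun i => C (widen_ord (leqnSn n) i)) _ (fun i => C0 _)
  (fun i => cfb (widen_ord (leqnSn n) i)).
have [g' cg'] := cfb ord_max.
exists (fun m w => g m w + C ord_max * g' m w)%R.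
under [X in compensator X _]eq_fun do under eq_fun do rewrite big_ord_recr.
exact: compensatorD cg (compensatorZ (C0 _) cg').
Qed.

(* The compensator of [a_m E(xi | F_m)] is [sum_(k < m) (a_k - a_(k+1)) E(xi | F_(k+1))]. *)
Lemma compensator_classV fb : classV F M fb -> exists g, compensator fb g.
Proof.
move=> [xi A0xi [afb [phi [[aphi phifin phidec] phiint phiY]]]].
have [mxi xi0 xii _] := A0xi.
(* [phi] is extended real-valued but almost surely finite, so the real-valued [a] can replace it. *)
pose a m w := fine (phi m w).
have mphi m : measurable_fun [set: T] (phi m) := sub_measurable_filtration hF (aphi m).
have aa m : sub_measurable (F m) (a m).
  by apply: measurableT_comp (aphi m); exact: fine_measurable.
have ma m : measurable_fun [set: T] (a m) := sub_measurable_filtration hF (aa m).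
have phia m : almost_surely M (fun w => phi m w = (a m w)%:E).
  move=> P MP; apply: filterS (probability1_ae _ (phifin P m MP)) => [w /= fw|].
    by rewrite /a fineK// fin_num_abs.
  rewrite -[X in measurable X]setTI; apply: emeasurable_fun_infty_o => //.
  exact: measurableT_comp.
have adec m : almost_surely M (fun w => (a m.+1 w <= a m w)%R).
  move=> P MP; apply: filterS3 (phia m P MP) (phia m.+1 P MP) (phidec m.+1 isT P MP).
  by move=> w /= -> ->; rewrite lee_fin.
have axi P m : M P -> P.-integrable [set: T] (EFin \o (fun w => a m w * xi w)%R).
  move=> MP; apply/(integrable_weight mxi (xi0 _ MP) (ma m)).
  apply: le_lt_trans (phiint P m MP); rewrite le_eqVlt; apply/orP; left; apply/eqP.
  apply: ae_eq_integral => //.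
  - apply/measurable_EFinP; apply: measurable_funM => //; exact: measurableT_comp.
  - apply: emeasurable_funM; first exact/measurable_EFinP.
    exact: measurableT_comp.
  - by apply: filterS (phia m P MP) => w -> _; rewrite /= -EFinM mulrC.
(* Versions are chosen under [P0] once and for all; [cond_exp_classA0] makes them valid for every
   [P] in [M]. *)
have /choice [Y hY] : forall m, exists Y : T -> R, is_cond_exp P0 (F m) xi Y /\
    {ae P0, forall w, (fb m w)%:E = phi m w * (Y w)%:E}.
  by move=> m; have [Y ? ?] := phiY P0 m hP0; exists Y.
have ceY P m : M P -> is_cond_exp P (F m) xi (Y m).
  by move=> MP; apply: (cond_exp_classA0 hF hequiv hP0 hdens MP A0xi); have [] := hY m.
have aY m : sub_measurable (F m) (Y m) by have [] := ceY P0 m hP0.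
have mY m : measurable_fun [set: T] (Y m) := sub_measurable_filtration hF (aY m).
have Y0 m : almost_surely M (fun w => (0 <= Y m w)%R).
  move=> P MP; exact: (cond_exp_ge0 (filtration_sigma_algebra hF m)
    (filtration_measurable hF (n := m)) mxi (xi0 P MP) (ceY P m MP)).
have fbE m : almost_surely M (fun w => fb m w = a m w * Y m w)%R.
  apply: (almost_surelyP0 hequiv hP0).
  by apply: filterS2 (proj2 (hY m)) (phia m P0 hP0) => w /= + phE; rewrite phE => -[].
(* For [k <= m] the factor [a k] is [F m]-measurable and comes out of the conditional
   expectation. *)
have ceaY P m k : M P -> (k <= m)%N ->
    is_cond_exp P (F m) (fun w => a k w * xi w)%R (fun w => a k w * Y m w)%R.
  move=> MP km; apply: (cond_exp_mul (filtration_sigma_algebra hF m)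
    (filtration_measurable hF (n := m)) mxi (xi0 P MP) (ceY P m MP)).
    exact: (sub_measurable_mono hF km).
  exact: axi.
have aYi P m k : M P -> (k <= m)%N -> P.-integrable [set: T] (EFin \o (fun w => a k w * Y m w)%R).
  by move=> MP km; have [] := ceaY P m k MP km.
pose g m w := (\sum_(k < m) (a k w - a k.+1 w) * Y k.+1 w)%R.
have gS m w : (g m.+1 w = g m w + (a m w * Y m.+1 w - a m.+1 w * Y m.+1 w))%R.
  by rewrite /g big_ord_recr/= mulrBl.
have ag : adapted F g.
  elim=> [|m IH].
    rewrite (_ : g 0%N = cst 0%R); first exact: measurable_cst.
    by apply/funext => w; rewrite /g big_ord0.
  rewrite (funext (gS m)); apply: measurable_funD.
    by apply: (sub_measurable_mono hF (leqnSn m)); exact: IH.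
  apply: measurable_funB; apply: measurable_funM; try exact: aY; try exact: aa.
  by apply: (sub_measurable_mono hF (leqnSn m)); exact: aa.
have gi P m : M P -> P.-integrable [set: T] (EFin \o g m).
  move=> MP; elim: m => [|m IH].
    rewrite (_ : EFin \o g 0%N = cst 0); first exact: integrable0.
    by apply/funext => w; rewrite /g/= big_ord0.
  rewrite (funext (gS m)).
  have aYB := integrableB measurableT (aYi P m.+1 m MP (leqnSn m)) (aYi P m.+1 m.+1 MP (leqnn _)).
  exact: (integrableD measurableT IH aYB).
have fbi P m : M P -> P.-integrable [set: T] (EFin \o fb m).
  move=> MP; apply: ae_integrable_eq (aYi P m m MP (leqnn m)).
    exact: (sub_measurable_filtration hF (afb m)).
  by apply: filterS (fbE m P MP) => w ->.
exists g; split => //.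
- by move=> w; rewrite /g big_ord0.
- move=> m P MP; apply: filterS2 (adec m P MP) (Y0 m.+1 P MP) => w aw Yw.
  by rewrite gS lerDl -mulrBl mulr_ge0// subr_ge0.
- move=> P m MP; split; [exact: fbi|exact: gi|].
  have ceg : is_cond_exp P (F m) (g m) (g m) := cond_exp_self (ag m) (gi P m MP).
  (* Conditioning [a m * xi] first on [F m.+1] and then on [F m] shows that [a m * Y m] is the
     conditional expectation of [a m * Y m.+1]. Since [fb m.+1 + g m.+1] is almost surely
     [g m + a m * Y m.+1], this is the martingale property. *)
  have step := cond_exp_tower (filtration_mono hF (leqnSn m))
    (ceaY P m.+1 m MP (leqnSn m)) (ceaY P m m MP (leqnn m)).
  have := cond_exp_add (filtration_measurable hF (n := m))
    (aYi P m.+1 m MP (leqnSn m)) (gi P m MP) step ceg.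
  have mN : sub_measurable (F m) (fun w => fb m w + g m w)%R.
    by apply: measurable_funD; [exact: afb|exact: ag].
  have aE : {ae P, forall w, (a m w * Y m w + g m w = fb m w + g m w)%R}.
    by apply: filterS (fbE m P MP) => w ->.
  move/(cond_exp_ae_eqr (filtration_measurable hF (n := m)) mN aE).
  apply: cond_exp_ae_eql => //.
  + exact: (filtration_measurable hF (n := m)).
  + apply: measurable_funD; first exact: measurable_funM.
    exact: (sub_measurable_filtration hF (ag m)).
  + apply: measurable_funD; first exact: (sub_measurable_filtration hF (afb m.+1)).
    exact: (sub_measurable_filtration hF (ag m.+1)).
  + apply: filterS (fbE m.+1 P MP) => w ->.
    by rewrite gS addrCA [in RHS](addrC (a m.+1 w * _)%R) subrK addrC.
Qed.

(** The bound is the same for all measures of [M], because [xi0] has expectation 1 under each of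
    them; it therefore also bounds suprema over [M]. *)
Lemma as_abs_expectation_le P X xi0 (C : R) : M P -> classA0 M xi0 -> (0 < C)%R ->
  measurable_fun [set: T] X ->
  almost_surely M (fun w => `|X w| <= C * xi0 w)%R ->
  \int[P]_w `|(X w)%:E| <= C%:E.
Proof.
move=> MP [mxi xi0_ge0 xii xi1] C0 mX Xle.
have -> : C%:E = \int[P]_w (Num.max (C * xi0 w) 0)%R%:E.
  rewrite -(@ae_integral_eq _ _ _ P (fun w => C * xi0 w)%R)//.
  - under eq_integral do rewrite EFinM.
    rewrite (integralZl measurableT (xii P MP)).
    by have := xi1 P MP; rewrite unlock => ->; rewrite mule1.
  - exact: measurable_funM.
  - by apply: measurable_pos; exact: measurable_funM.
  - by apply: ae_pos; apply: filterS (xi0_ge0 P MP) => w ?; rewrite mulr_ge0// ltW.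
apply: ae_ge0_le_integral => //.
- by apply: measurableT_comp => //; exact/measurable_EFinP.
- by move=> w _; rewrite lee_fin le_max lexx orbT.
- by apply/measurable_EFinP; apply: measurable_pos; exact: measurable_funM.
- by apply: filterS (Xle P MP) => w Xw _; rewrite lee_fin le_max Xw.
Qed.

Lemma classK_local_regular f xi0 (C : R) : supermartingale F M f ->
  classA0 M xi0 -> (0 < C)%R ->
  (forall m, (1 <= m)%N -> almost_surely M (fun w => `|f m w| <= C * xi0 w)%R) ->
  classK F M f -> local_regular F M f.
Proof.
move=> hf hxi0 C0 hbound [n [c [fb [_ c0 Vfb fE]]]].
have [af fi _] := hf.
have mf m : measurable_fun [set: T] (f m) := sub_measurable_filtration hF (af m).
have [g [ab ag g0 gi ceg]] := compensator_sum c0 (fun i => compensator_classV (Vfb i)).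
pose b m w := (\sum_(i < n) c i * fb i m w)%R.
have mb m : measurable_fun [set: T] (b m) := sub_measurable_filtration hF (ab m).
have mg m : measurable_fun [set: T] (g m) := sub_measurable_filtration hF (ag m).
(* The definition of a supermartingale gives integrability from index 1 on; index 0 is obtained from
   the compensated sum. *)
have fi' P m : M P -> P.-integrable [set: T] (EFin \o f m).
  move=> MP; have [bi _ _] := ceg P m MP; apply: ae_integrable_eq bi => //.
  by apply: filterS (fE m P MP) => w ->.
have gint P m : M P -> P.-integrable [set: T] (EFin \o g m).
  by move=> MP; have [] := ceg P m MP.
have step P m : M P ->
    is_cond_exp P (F m) (fun w => f m.+1 w + g m.+1 w)%R (fun w => f m w + g m w)%R.
  move=> MP; have [_ _ ce] := ceg P m MP.
  have mfg : sub_measurable (F m) (fun w => f m w + g m w)%R.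
    by apply: measurable_funD; [exact: af|exact: ag].
  have aE k : {ae P, forall w, (b k w + g k w = f k w + g k w)%R}.
    by apply: filterS (fE k P MP) => w ->.
  apply: (cond_exp_ae_eqr (filtration_measurable hF (n := m)) mfg (aE m)).
  have mbg : measurable_fun [set: T] (fun w => b m.+1 w + g m.+1 w)%R.
    exact: measurable_funD.
  have mfg1 : measurable_fun [set: T] (fun w => f m.+1 w + g m.+1 w)%R.
    exact: measurable_funD.
  exact: (cond_exp_ae_eql (filtration_measurable hF (n := m)) mbg mfg1 (aE m.+1) ce).
have afg : adapted F (fun m w => f m w + g m w)%R.
  by move=> m; apply: measurable_funD; [exact: af|exact: ag].
have fgi P m : M P -> P.-integrable [set: T] (EFin \o (fun w => f m w + g m w)%R).
  by move=> MP; exact: (integrableD measurableT (fi' P m MP) (gint P m MP)).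
have mart := martingale_step hF afg fgi step.
have g_ge0 m : almost_surely M (fun w => (0 <= g m w)%R).
  move=> P MP; elim: m => [|m IH]; first by apply: aeW => w; rewrite g0.
  by apply: filterS2 IH (gi m P MP) => w; exact: le_trans.
split => //.
  move=> m m1; apply: (@le_lt_trans _ _ C%:E); last exact: ltry.
  apply: ge_ereal_sup => _ [P MP <-]; rewrite unlock.
  by apply: (as_abs_expectation_le MP hxi0 C0) => //; exact: hbound.
exists g; split => //; first by move=> P MP; exact: aeW.
(* The martingale [f + g] has constant expectation [f_0], so [E g_m = f_0 - E f_m], which is at most
   [f_0 + C] for [m >= 1]. *)
split=> // m m1; apply: (@le_lt_trans _ _ (f 0%N point + C)%:E); last exact: ltry.
apply: ge_ereal_sup => _ [P MP <-]; rewrite unlock.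
have -> : \int[P]_w (`|g m w|)%:E = \int[P]_w (g m w)%:E.
  apply: ae_integral_eq => //; first exact: measurableT_comp.
  by apply: filterS (g_ge0 m P MP) => w gw; rewrite ger0_norm.
have intN : \int[P]_w (f m w + g m w)%:E = (f 0%N point)%:E.
  have [_ _ /(_ P 0%N m MP isT)[Y [mY' _ YE] YN]] := mart.
  rewrite -(YE _ (filtrationT hF 0)).
  have mY := sub_measurable_filtration hF mY'.
  have m0 : measurable_fun [set: T] (fun w => f 0%N w + g 0%N w)%R by exact: measurable_funD.
  rewrite (ae_integral_eq measurableT mY m0 YN).
  transitivity ((f 0%N point)%:E * P [set: T]); last by rewrite probability_setT mule1.
  rewrite -integral_cst//; apply: eq_integral => w _.
  by rewrite g0 addr0 (sub_measurable0_cst hF (af 0%N)).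
have -> : \int[P]_w (g m w)%:E = (f 0%N point)%:E - \int[P]_w (f m w)%:E.
  rewrite -intN integralD_EFin//; [|exact: fi'|exact: gint].
  by rewrite addeAC subee ?add0e//; apply: integrable_fin_num => //; exact: fi'.
rewrite EFinD leeD2l//; apply: le_trans (lee_abs _) _; rewrite abseN.
apply: le_trans (le_abse_integral _ measurableT _) _; first exact/measurable_EFinP.
by apply: (as_abs_expectation_le MP hxi0 C0) => //; exact: hbound.
Qed.

End Sufficiency.

(** * Limits along ultrafilters *)

Lemma ultrafilter_fmap {S U : Type} (h : S -> U) (W : set_system S) :
  UltraFilter W -> UltraFilter (fmap h W).
Proof.
move=> UW; split=> [|K PK WK]; first exact: fmap_proper_filter.
apply/seteqP; split => // B KB.
have [//|nB] := in_ultra_setVsetC (h @^-1` B) UW.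
have KnB : K (~` B) by apply: WK.
have : K set0 by rewrite -(setICr B); exact: filterI.
by move/filter_not_empty.
Qed.

(** Compactness of [[a, b]]: every ultrafilter containing the segment converges in it. *)
Lemma bounded_ultrafilter_cvg {R : realType} {S : Type} (W : set_system S)
    (u : S -> R) (a b : R) : UltraFilter W ->
  (forall s, a <= u s <= b) -> cvg (u s @[s --> W]).
Proof.
move=> UW uab; have := @segment_compact R a b.
rewrite compact_ultra => /(_ _ (ultrafilter_fmap u UW)) [|l [_ ul]].
  apply: (@filterS _ W _ setT) => [s _|]; last exact: filterT.
  by rewrite /= in_itv /=.
by apply/cvg_ex; exists l.
Qed.

(** * Weak limits of a dominated sequence of densities *)

Section DominatedWeakLimit.
Context {d : measure_display} {T : measurableType d} {R : realType}.
Variables (P : probability T R) (X : nat -> T -> R) (H : T -> \bar R).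
Hypotheses (mX : forall m, measurable_fun [set: T] (X m))
  (X0 : forall m w, 0 <= X m w) (iH : P.-integrable [set: T] H)
  (H0 : forall w, (0 <= H w)%E)
  (XH : forall m, {ae P, forall w, ((X m w)%:E <= H w)%E}).
Local Open Scope ereal_scope.

(** [J _ m] is the measure with density [X m], and [eta] the finite measure with density [H] that
    dominates all of them; both take real values so that limits are taken in [R]. *)
Let J A m := fine (\int[P]_(w in A) (X m w)%:E).

Let eta A := fine (\int[P]_(w in A) H w).

Let etaE A : measurable A -> \int[P]_(w in A) H w = (eta A)%:E.
Proof.
move=> mA; rewrite /eta fineK//; apply: integrable_fin_num => //.
exact: integrableS iH.
Qed.

Let int_le A m : measurable A -> \int[P]_(w in A) (X m w)%:E <= (eta A)%:E.
Proof.
move=> mA; rewrite -etaE//; apply: ae_ge0_le_integral => //.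
- by move=> w _; rewrite lee_fin.
- exact/measurable_funTS/measurable_EFinP.
- exact: measurable_funTS (measurable_int _ iH).
- by apply: filterS (XH m) => w.
Qed.

Let int_ge0 A m : 0 <= \int[P]_(w in A) (X m w)%:E.
Proof. by apply: integral_ge0 => w _; rewrite lee_fin. Qed.

Let IE A m : measurable A -> \int[P]_(w in A) (X m w)%:E = (J A m)%:E.
Proof.
move=> mA; rewrite /J fineK// ge0_fin_numE; last exact: int_ge0.
exact: le_lt_trans (int_le m mA) (ltry _).
Qed.

Let I_bound A m : measurable A -> (0 <= J A m <= eta A)%R.
Proof. by move=> mA; rewrite -!lee_fin -IE// int_ge0 int_le. Qed.

(** The limit [L] of the [J _ m] is finitely additive and lies below [eta], from which it inherits
    countable additivity; [xi] is its density. The last clause recovers every integral that is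
    eventually constant in [m], which is how conditional expectations of [xi] are identified. *)
Lemma dominated_weak_limit : exists xi : T -> R,
  [/\ measurable_fun [set: T] xi, {ae P, forall w, (0 <= xi w)%R},
      P.-integrable [set: T] (EFin \o xi) &
      forall A (v : \bar R), measurable A ->
        (\forall m \near \oo, \int[P]_(w in A) (X m w)%:E = v) ->
        \int[P]_(w in A) (xi w)%:E = v].
Proof.
(* [W] refines the filter [\oo], so an eventual value of a sequence is also its limit along [W]. *)
have [W [UW ooW]] := @ultraFilterLemma nat \oo _.
have PW : ProperFilter W by exact: ultra_proper.
pose L A : R := lim (J A m @[m --> W]).
have cL A : measurable A -> J A m @[m --> W] --> L A.
  move=> mA; apply: (bounded_ultrafilter_cvg (a := 0%R) (b := eta A) UW).
  by move=> m; exact: I_bound.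
have L_bound A : measurable A -> (0 <= L A <= eta A)%R.
  move=> mA; apply/andP; split.
  - apply: limr_ge; first by apply/cvg_ex; exists (L A); exact: cL.
    by apply: nearW => m; have /andP[] := I_bound m mA.
  - apply: limr_le; first by apply/cvg_ex; exists (L A); exact: cL.
    by apply: nearW => m; have /andP[] := I_bound m mA.
have LU A B : measurable A -> measurable B -> [disjoint A & B] ->
    L (A `|` B) = (L A + L B)%R.
  move=> mA mB AB; apply: (cvg_unique _ (cL _ (measurableU _ _ mA mB))) => //.
  have -> : J (A `|` B) = (fun m => J A m + J B m)%R.
    apply/funext => m; apply: EFin_inj; rewrite EFinD -!IE//; last exact: measurableU.
    apply: ge0_integral_setU => //.
    - apply/measurable_funTS/measurable_EFinP; exact: mX.
    - by move=> w _; rewrite lee_fin.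
  exact: (cvgD (cL _ mA) (cL _ mB)).
have etaU A B : measurable A -> measurable B -> [disjoint A & B] ->
    eta (A `|` B) = (eta A + eta B)%R.
  move=> mA mB AB; apply: EFin_inj; rewrite EFinD -!etaE//; last exact: measurableU.
  apply: ge0_integral_setU => //.
  exact: measurable_funTS (measurable_int _ iH).
pose nu A : \bar R := (L A)%:E.
have nu0 : nu set0 = 0.
  have /andP[l0] := L_bound _ (measurable0 : measurable (set0 : set T)).
  rewrite /eta integral_set0 /= => l0'; congr EFin.
  by apply/eqP; rewrite eq_le l0 l0'.
have nu_sigma : semi_sigma_additive nu.
  move=> B mB tB mUB.
  pose U n := \big[setU/set0]_(i < n) B i.
  have mU n : measurable (U n) by exact: bigsetU_measurable.
  have disjU n : [disjoint U n & B n].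
    apply/disj_setPS => w []; rewrite /U -bigcup_mkord => -[i /= im Bi] Bn.
    have E : i = n by apply: (tB i n I I); exists w.
    by rewrite E ltnn in im.
  have sumL n : L (U n) = (\sum_(i < n) L (B i))%R.
    elim: n => [|n IH]; first by rewrite /U !big_ord0; apply: EFin_inj.
    by rewrite big_ord_recr/= -IH -LU// /U big_ord_recr.
  have sumeta n : eta (U n) = (\sum_(i < n) eta (B i))%R.
    elim: n => [|n IH]; first by rewrite /U !big_ord0 /eta integral_set0.
    by rewrite big_ord_recr/= -IH -etaU// /U big_ord_recr.
  set S := \bigcup_n B n.
  have USE n : S = U n `|` (S `\` U n).
    rewrite setDUK// /U -bigcup_mkord.
    by move=> w [i _ Bi]; exists i.
  have disjS n : [disjoint U n & S `\` U n] by apply/disj_setPS => w [? []].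
  have mSU n : measurable (S `\` U n) by exact: measurableD.
  (* The part of [S] outside [U n] has [L]-mass between 0 and its [eta]-mass, and the latter is the
     tail of a convergent series. *)
  have bnd n : (L S - (eta S - \sum_(i < n) eta (B i)) <= \sum_(i < n) L (B i) <= L S)%R.
    rewrite -sumL -sumeta [in L S](USE n) [in eta S](USE n) LU// etaU//.
    have /andP[l0 l1] := L_bound _ (mSU n).
    by rewrite [(eta (U n) + _)%R]addrC addrK lerBlDr lerD2l l1 lerDl.
  have cvg_eta : (\sum_(i < n) eta (B i))%R @[n --> \oo] --> eta S.
    have := @charge_semi_sigma_additive _ _ _ (induced_charge iH) B mB tB mUB.
    rewrite [X in _ --> X](etaE mUB) => /fine_cvg; apply: cvg_trans.
    apply: near_eq_cvg; apply: nearW => n /=; rewrite big_mkord.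
    by rewrite (eq_bigr (fun i : 'I_n => (eta (B i))%:E)) ?sumEFin// => i _; exact: etaE.
  have -> : (fun n => \sum_(0 <= i < n) nu (B i)) = EFin \o (fun n => \sum_(i < n) L (B i))%R.
    by apply/funext => n; rewrite /nu/= sumEFin big_mkord.
  apply: cvg_EFin; first exact: nearW.
  apply: (@squeeze_cvgr _ _ _ _ (fun n => L S - (eta S - \sum_(i < n) eta (B i))) (cst (L S)))%R.
  - by apply: nearW => n; exact: bnd.
  - rewrite -[X in _ --> X]subr0 -[X in _ --> (_ - X)%R](subrr (eta S)).
    apply: cvgB; first exact: cvg_cst.
    by apply: cvgB => //; exact: cvg_cst.
  - exact: cvg_cst.
(* Packing [nu] as a charge makes its Radon-Nikodym derivative available; nonnegativity of that
   derivative is recovered from [L_bound]. *)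
pose nuC := isCharge.Build _ T R nu nu0 (fun _ _ => isT) nu_sigma.
pose nu' : {charge set T -> \bar R} := HB.pack nu nuC.
have nuP : nu' `<< P.
  apply/null_content_dominatesP => A mA PA.
  have : eta A = 0%R.
    rewrite /eta null_set_integral//.
    exact: measurable_funTS (measurable_int _ iH).
  have /andP[l0 l1] := L_bound _ mA => eA; rewrite eA in l1.
  by rewrite /= /nu; congr EFin; apply/eqP; rewrite eq_le l0 l1.
have xiE : EFin \o (fine \o Radon_Nikodym nu' P) = Radon_Nikodym nu' P.
  by apply/funext => w; rewrite /= fineK// Radon_Nikodym_fin_num.
have xii : P.-integrable [set: T] (EFin \o (fine \o Radon_Nikodym nu' P)).
  by rewrite xiE; exact: Radon_Nikodym_integrable.
have xiL A : measurable A -> \int[P]_(w in A) (fine (Radon_Nikodym nu' P w))%:E = (L A)%:E.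
  move=> mA; rewrite -[RHS]/(nu' A) (Radon_Nikodym_integral nuP mA).
  by apply: eq_integral => w _; rewrite fineK// Radon_Nikodym_fin_num.
exists (fine \o Radon_Nikodym nu' P); split => //.
- exact: integrable_measurable xii.
- apply: ge0_integral_ae_ge0 => //; set N := [set w | _].
  have mN : measurable N.
    have := integrable_measurable xii measurableT (measurable_itv `]-oo, 0%R[).
    rewrite setTI (_ : _ @^-1` _ = N); first by [].
    by apply/seteqP; split => w /=; rewrite in_itv.
  by rewrite xiL// lee_fin; have /andP[] := L_bound _ mN.
- move=> A v mA vA; rewrite xiL//.
  have [m mv] : exists m, \int[P]_(w in A) (X m w)%:E = v.
    exact: filter_ex vA.
  rewrite -mv IE//; congr EFin.
  apply: (cvg_unique _ (cL _ mA)) => //.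
  apply: (@cvg_trans _ (cst (J A m) m' @[m' --> W])); last exact: cvg_cst.
  apply: near_eq_cvg; apply: ooW; apply: filterS vA => k kv.
  by rewrite /J mv kv.
Qed.

End DominatedWeakLimit.

(** * Local regular processes under the bound by [xi0] belong to [classK] *)

Section Necessity.
Context {d : measure_display} {T : measurableType d} {R : realType}.
Variables (F : nat -> set (set T)) (M : set (probability T R)) (P0 : probability T R).
Hypotheses (hF : is_filtration F) (hequiv : pairwise_equivalent M) (hP0 : M P0).
Hypothesis hdens : density_condition F M P0.
Implicit Types (P Q : probability T R) (X Y Z : T -> R).
Local Open Scope ereal_scope.

(** The nonincreasing factor is the constant [r]. Its sign is free, which puts negative multiples of
    a conditional expectation into [classV] although [classK] admits only nonnegative
    coefficients. *)
Lemma classV_scaled_cond_exp (r : R) xi (Y : nat -> T -> R) : classA0 M xi ->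
  (forall m, is_cond_exp P0 (F m) xi (Y m)) ->
  classV F M (fun m w => r * Y m w)%R.
Proof.
move=> A0xi ceY; have [mxi xi0 xii xi1] := A0xi; exists xi => //; split.
  by move=> m; apply: measurable_funM; [exact: measurable_cst|have [] := ceY m].
exists (fun _ => cst r%:E); split.
- split.
  + by move=> m; exact: measurable_cst.
  + move=> P m _; rewrite (_ : [set w | _] = [set: T]) ?probability_setT//.
    by apply/seteqP; split => // w _; rewrite /= ltry.
  + by move=> m _ P _; exact: aeW.
- move=> P m MP; under eq_integral do rewrite muleC.
  rewrite (integralZl measurableT (xii P MP) `|r|).
  by have := xi1 P MP; rewrite unlock => ->; rewrite mule1 ltry.
- move=> P m MP; exists (Y m); last by apply: aeW => w; rewrite EFinM.
  exact: (cond_exp_classA0 hF hequiv hP0 hdens MP A0xi (ceY m)).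
Qed.

Lemma classA0_1 : classA0 M (cst 1%R).
Proof.
split.
- exact: measurable_cst.
- by move=> P _; exact: aeW.
- by move=> P _; exact: finite_measure_integrable_cst.
- move=> P _; rewrite unlock.
  transitivity (1 * P [set: T]); last by rewrite probability_setT mule1.
  by rewrite -integral_cst.
Qed.

(** With [xi = 1] the conditional expectations are 1, so the integrable nonincreasing process [- g]
    can itself serve as the factor. *)
Lemma classV_decreasing (g : nat -> T -> R) : adapted F g ->
  (forall m, almost_surely M (fun w => g m w <= g m.+1 w)%R) ->
  (forall P m, M P -> P.-integrable [set: T] (EFin \o g m)) ->
  classV F M (fun m w => - g m w)%R.
Proof.
move=> ag gi gint; exists (cst 1%R); first exact: classA0_1.
have aNg m : sub_measurable (F m) (fun w => - g m w)%R by exact: measurable_funN (ag m).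
split => //; exists (fun m w => (- g m w)%:E); split.
- split.
  + by move=> m; apply/measurable_EFinP; exact: aNg.
  + move=> P m _; rewrite (_ : [set w | _] = [set: T]) ?probability_setT//.
    by apply/seteqP; split => // w _; rewrite /= ltry.
  + move=> [//|m] _ P MP; apply: filterS (gi m P MP) => w.
    by rewrite lee_fin lerN2.
- move=> P m MP; have /integrableP[_] := gint P m MP; apply: le_lt_trans.
  rewrite le_eqVlt; apply/orP; left; apply/eqP; apply: eq_integral => w _ /=.
  by rewrite mul1e normrN.
- move=> P m MP; exists (cst 1%R); last by apply: aeW => w; rewrite /= mule1.
  by apply: cond_exp_self; [exact: measurable_cst|exact: finite_measure_integrable_cst].
Qed.

Lemma martingale_cond_exp (N : nat -> T -> R) P k m : martingale F M N ->
  M P -> (k <= m)%N -> is_cond_exp P (F k) (N m) (N k).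
Proof.
move=> [aN _ ceN] MP km; have [Y ceY YN] := ceN P k m MP km.
exact: (cond_exp_ae_eqr (filtration_measurable hF (n := k)) (aN k) YN).
Qed.

(** The definition of a martingale grants integrability from index 1 on; writing [N m] as a
    conditional expectation of [N m.+1] covers index 0 too. *)
Lemma martingale_integrable (N : nat -> T -> R) P m : martingale F M N ->
  M P -> P.-integrable [set: T] (EFin \o N m).
Proof.
by move=> mN MP; have [] := martingale_cond_exp mN MP (leqnSn m).
Qed.

Lemma martingale_expectation (N : nat -> T -> R) P m : martingale F M N ->
  M P -> \int[P]_w (N m w)%:E = (N 0%N point)%:E.
Proof.
move=> mN MP; have [_ _ /(_ _ (filtrationT hF 0)) <-] := martingale_cond_exp mN MP (leq0n m).
have [aN _ _] := mN.
transitivity ((N 0%N point)%:E * P [set: T]); last by rewrite probability_setT mule1.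
rewrite -integral_cst//; apply: eq_integral => w _.
by rewrite (sub_measurable0_cst hF (aN 0%N)).
Qed.

(** The start is cut at 0 so that all running maxima are nonnegative everywhere. *)
Fixpoint running_max (g : nat -> T -> R) (m : nat) : T -> R :=
  if m is k.+1 then fun w => Num.max (running_max g k w) (g m w)
  else fun w => Num.max (g 0%N w) 0%R.

(* An almost surely nondecreasing sequence is made nondecreasing everywhere
   by taking running maxima, so that monotone convergence applies. *)
Lemma integrable_sup_nondecreasing P (g : nat -> T -> R) (c : R) :
  (forall m, measurable_fun [set: T] (g m)) ->
  (forall m, {ae P, forall w, (0 <= g m w)%R}) ->
  (forall m, {ae P, forall w, (g m w <= g m.+1 w)%R}) ->
  (forall m, \int[P]_w (g m w)%:E <= c%:E) ->
  exists H : T -> \bar R, [/\ P.-integrable [set: T] H, forall w, 0 <= H w &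
    forall m, {ae P, forall w, (g m w)%:E <= H w}].
Proof.
move=> mg g0 gi gc; pose h := running_max g.
have mh m : measurable_fun [set: T] (h m).
  by elim: m => [|m IH]; [exact: measurable_pos|exact: measurable_maxr].
have h0 m w : (0 <= h m w)%R.
  by elim: m => [|m IH]; rewrite /h/= le_max ?lexx ?orbT// IH.
have gh m w : (g m w <= h m w)%R.
  by case: m => [|m]; rewrite /h/= le_max lexx ?orbT.
have hS w : {homo h^~ w : n m / (n <= m)%N >-> (n <= m)%R}.
  by apply/nondecreasing_seqP => n; rewrite /h/= le_max lexx.
have hg m : {ae P, forall w, h m w = g m w}.
  elim: m => [|m IH]; first by apply: filterS (g0 0%N) => w ?; rewrite /h/= max_l.
  by apply: filterS2 IH (gi m) => w hE ?; rewrite /h/= -/h hE max_r.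
pose H w := limn (fun m => (h m w)%:E).
have ndh w : {homo (fun m => (h m w)%:E) : n m / (n <= m)%N >-> n <= m}.
  by move=> n m nm; rewrite lee_fin; exact: hS.
have cH w : (h m w)%:E @[m --> \oo] --> H w.
  have := ereal_nondecreasing_cvgn (ndh w) => cs.
  by rewrite /H (cvg_lim _ cs).
have hH m w : (h m w)%:E <= H w.
  rewrite /H (cvg_lim _ (ereal_nondecreasing_cvgn (ndh w)))//.
  by apply: ereal_sup_ubound; exists m.
have H0 w : 0 <= H w by apply: le_trans (hH 0%N w); rewrite lee_fin.
have mEh m : measurable_fun [set: T] (EFin \o h m) by exact/measurable_EFinP.
have mH : measurable_fun [set: T] H.
  by apply: (emeasurable_fun_cvg (fun m => EFin \o h m)) => // w _; exact: cH.
exists H; split => //.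
- apply/integrableP; split => //.
  under eq_integral do rewrite gee0_abs//.
  apply: (@le_lt_trans _ _ c%:E); last exact: ltry.
  have cv := @cvg_monotone_convergence _ _ _ P _ measurableT (fun m => EFin \o h m) mEh
    (fun m w _ => h0 m w) (fun w _ => ndh w).
  rewrite -(cvg_lim _ cv)//; apply: lime_le; first by apply/cvg_ex; exists (\int[P]_w H w).
  apply: nearW => m; apply: le_trans (gc m).
  by rewrite (ae_integral_eq measurableT (mh m) (mg m) (hg m)).
- by move=> m; apply: aeW => w; apply: le_trans (hH m w); rewrite lee_fin.
Qed.

Lemma local_regular_classK f xi0 (C : R) : classA0 M xi0 -> (0 < C)%R ->
  (forall m, (1 <= m)%N -> almost_surely M (fun w => `|f m w| <= C * xi0 w)%R) ->
  local_regular F M f -> classK F M f.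
Proof.
move=> A0xi0 C0 hbound [[af fi _] _ [g [ag g0 gi g00 [gsup mN]]]].
have [mxi0 xi0_ge0 xi0i xi01] := A0xi0.
pose N m w := (f m w + g m w)%R; pose c := N 0%N point.
have mf m : measurable_fun [set: T] (f m) := sub_measurable_filtration hF (af m).
have mg m : measurable_fun [set: T] (g m) := sub_measurable_filtration hF (ag m).
have mNT m : measurable_fun [set: T] (N m) by exact: measurable_funD.
have gint P m : M P -> P.-integrable [set: T] (EFin \o g m).
  move=> MP; case: m => [|m].
    apply: (ae_integrable_eq (mg 0%N) (X := cst 0%R)); last exact: integrable0.
    by apply: filterS (g00 P MP) => w ->.
  apply/integrableP; split; first exact/measurable_EFinP.
  apply: le_lt_trans (gsup m.+1 isT); apply: ereal_sup_ubound; exists P => //.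
  by rewrite unlock.
have Ni P m : M P -> P.-integrable [set: T] (EFin \o N m).
  by move=> MP; exact: martingale_integrable mN MP.
(* [D] dominates the bound and makes the total mass [c + D] positive. *)
pose D := (C + `|c| + 1)%R.
have CD : (C <= D)%R by rewrite /D -addrA lerDl addr_ge0.
have D0 : (0 < D)%R by exact: lt_le_trans CD.
have hboundD m : (1 <= m)%N -> almost_surely M (fun w => `|f m w| <= D * xi0 w)%R.
  move=> m1 P MP; apply: filterS2 (hbound m m1 P MP) (xi0_ge0 P MP) => w fC x0.
  by apply: le_trans fC _; exact: ler_wpM2r.
(* [kappa] will be the expectation of the limit [xs] under every measure of [M]; dividing [xs] by it
   gives a member of [classA0]. *)
pose kappa := (c + D)%R.
have kappa0 : (0 < kappa)%R.
  rewrite /kappa /D (addrC C) -(addrA `|c|%R) (addrA c) ltr_wpDl ?addr_gt0//.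
  by rewrite -lerBlDl sub0r -normrN ler_norm.
have /choice [Y ceY] : forall m, exists Y, is_cond_exp P0 (F m) xi0 Y.
  move=> m; apply: (cond_exp_exists (filtration_measurable hF (n := m))
    (filtration_sigma_algebra hF m)).
  exact: xi0i.
have mDxi : measurable_fun [set: T] (fun w => D * xi0 w)%R by exact: measurable_funM.
have Dxii : P0.-integrable [set: T] (EFin \o (fun w => D * xi0 w)%R).
  exact: (integrableZl measurableT D (xi0i P0 hP0)).
(* The index is shifted by one because the bound on [f] starts at 1. It gives [f + D * xi0 >= 0], so
   [X0 m] is almost surely nonnegative and [X m] is a version nonnegative everywhere. *)
pose X0 m w := (N m.+1 w + D * xi0 w)%R.
pose X m w := Num.max (X0 m w) 0%R.
have mX0 m : measurable_fun [set: T] (X0 m) by exact: measurable_funD.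
have mX m : measurable_fun [set: T] (X m) by exact: measurable_pos.
have X0E m : {ae P0, forall w, X0 m w = X m w}.
  apply: ae_pos; apply: filterS2 (hboundD m.+1 isT P0 hP0) (g0 m.+1 P0 hP0) => w fD gw.
  rewrite /X0 /N addrAC addr_ge0// -lerBlDr sub0r.
  by move: fD; rewrite ler_norml => /andP[].
(* [E g_m = c - E f_m] is at most [c + D], so the [g m] have a common integrable majorant. *)
have [G [Gi G0 gG]] : exists G : T -> \bar R, [/\ P0.-integrable [set: T] G,
    forall w, 0 <= G w & forall m, {ae P0, forall w, (g m w)%:E <= G w}].
  apply: (@integrable_sup_nondecreasing P0 g kappa) => //.
  - by move=> m; exact: g0.
  - by move=> m; exact: gi.
  move=> m.
  have fiM : P0.-integrable [set: T] (EFin \o f m).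
    have := integrableB measurableT (Ni P0 m hP0) (gint P0 m hP0).
    by apply: eq_integrable => // w _; rewrite /= -EFinB /N addrK.
  have : \int[P0]_w (g m w)%:E = c%:E - \int[P0]_w (f m w)%:E.
    rewrite -(martingale_expectation m mN hP0) integralD_EFin//; last exact: gint.
    by rewrite addeAC subee ?add0e//; apply: integrable_fin_num.
  move=> ->; rewrite /kappa (EFinD c D) leeD2l//.
  (* The bound on [f] does not cover index 0; there [E f_0 = c], and [- c <= D] by the choice of
     [D]. *)
  case: m fiM => [|m] fiM; last first.
    apply: le_trans (lee_abs _) _; rewrite abseN.
    apply: le_trans (le_abse_integral _ measurableT _) _; first exact/measurable_EFinP.
    exact: (as_abs_expectation_le hP0 A0xi0 D0 (mf m.+1) (hboundD m.+1 isT)).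
  have -> : \int[P0]_w (f 0%N w)%:E = c%:E.
    rewrite -(martingale_expectation 0 mN hP0).
    have f0N : {ae P0, forall w, f 0%N w = N 0%N w}.
      by apply: filterS (g00 P0 hP0) => w g0w; rewrite /N g0w addr0.
    exact: (ae_integral_eq measurableT (mf 0%N) (mNT 0%N) f0N).
  rewrite -EFinN lee_fin /D -addrA -[leLHS]add0r; apply: lerD; first exact: ltW.
  by rewrite -normrN (le_trans (ler_norm _))// lerDl.
pose Xi0 w := ((Num.max (D * xi0 w) 0)%R)%:E.
have Xi0i : P0.-integrable [set: T] Xi0.
  apply: (ae_integrable_eq (X := fun w => D * xi0 w)%R) Dxii; first exact: measurable_pos.
  by apply: ae_pos; apply: filterS (xi0_ge0 P0 hP0) => w ?; rewrite mulr_ge0// ltW.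
have Xi00 w : 0 <= Xi0 w by rewrite lee_fin le_max lexx orbT.
pose H w := Xi0 w + Xi0 w + G w.
have Hi : P0.-integrable [set: T] H.
  exact: (integrableD measurableT (integrableD measurableT Xi0i Xi0i) Gi).
have XH m : {ae P0, forall w, (X m w)%:E <= H w}.
  apply: filterS2 (hboundD m.+1 isT P0 hP0) (gG m.+1) => w fD gw.
  rewrite EFin_max ge_max; apply/andP; split; last by rewrite !adde_ge0.
  have DX : (D * xi0 w)%:E <= Xi0 w by rewrite lee_fin le_max lexx.
  rewrite /X0 /N addrAC !EFinD; apply: leeD => //; apply: leeD => //.
  by apply: le_trans DX; rewrite lee_fin; apply: le_trans fD; exact: ler_norm.
have X_ge0 m w : (0 <= X m w)%R by rewrite le_max lexx orbT.
have H0 w : 0 <= H w by rewrite !adde_ge0.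
have [xs [mxs xs0 xsi xsE]] := dominated_weak_limit mX X_ge0 Hi H0 XH.
pose Z m w := (N m w + D * Y m w)%R.
have aY m : sub_measurable (F m) (Y m) by have [] := ceY m.
have aZ m : sub_measurable (F m) (Z m).
  apply: measurable_funD; first by have [aN _ _] := mN; exact: aN.
  by apply: measurable_funM; [exact: measurable_cst|exact: aY].
have ceX0 k m : (k <= m)%N -> is_cond_exp P0 (F k) (X0 m) (Z k).
  move=> km; have GT := filtration_measurable hF (n := k).
  have ceD := cond_exp_scale GT D (xi0i P0 hP0) (ceY k).
  exact: (cond_exp_add GT (Ni P0 m.+1 hP0) Dxii (martingale_cond_exp mN hP0 (leqW km)) ceD).
(* For [A] in [F k], the integral of [X m] over [A] equals that of [Z k] as soon as [m >= k]; being
   eventually constant, it is also the integral of [xs]. *)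
have ceZ k : is_cond_exp P0 (F k) xs (Z k).
  have [_ Zi _] := ceX0 k k (leqnn k); split => // A FA.
  apply/esym; apply: xsE; first exact: (filtration_measurableW hF FA).
  exists k => // m /= km.
  have [_ _ ->//] := ceX0 k m km.
  by apply/esym/ae_integral_eq => //; exact: (filtration_measurableW hF FA).
have xs0M : almost_surely M (fun w => (0 <= xs w)%R) := almost_surelyP0 hequiv hP0 xs0.
(* Index 1 is where the measure can first be changed. [Z 1] is integrable under every [P] in [M], so
   [xs] is too, and both have expectation [c + D]. *)
have xsP P : M P -> P.-integrable [set: T] (EFin \o xs) /\ \int[P]_w (xs w)%:E = kappa%:E.
  move=> MP.
  have ceYP := cond_exp_classA0 hF hequiv hP0 hdens MP A0xi0 (ceY 1%N).
  have [_ YPi YPE] := ceYP.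
  have DYPi : P.-integrable [set: T] (EFin \o (fun w => D * Y 1%N w)%R).
    exact: (integrableZl measurableT D YPi).
  have ZPi : P.-integrable [set: T] (EFin \o Z 1%N).
    exact: (integrableD measurableT (Ni P 1%N MP) DYPi).
  have [[_ _ ZE] xsPi] := cond_exp_equivalent hF hequiv hP0 hdens hP0 MP (leqnn 1)
    mxs xs0M (ceZ 1%N) (or_intror ZPi).
  split => //; rewrite -ZE; last exact: filtrationT hF 1%N.
  rewrite integralD_EFin//; last exact: Ni.
  rewrite (martingale_expectation 1 mN MP) /kappa (EFinD c D); congr (_ + _).
  under eq_integral do rewrite /= EFinM.
  rewrite (integralZl measurableT YPi) YPE; last exact: filtrationT hF 1%N.
  by have := xi01 P MP; rewrite unlock => ->; rewrite mule1.
pose xi1 w := (kappa^-1 * xs w)%R.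
have A0xi1 : classA0 M xi1.
  split.
  - exact: measurable_funM.
  - by move=> P MP; apply: filterS (xs0M P MP) => w xw; rewrite mulr_ge0// invr_ge0 ltW.
  - by move=> P MP; exact: (integrableZl measurableT kappa^-1 (xsP P MP).1).
  - move=> P MP; rewrite unlock.
    under eq_integral do rewrite EFinM.
    rewrite (integralZl measurableT (xsP P MP).1) (xsP P MP).2 -EFinM mulVf// gt_eqF//.
have V1 := classV_scaled_cond_exp 1 A0xi1
  (fun m => cond_exp_scale (filtration_measurable hF (n := m)) kappa^-1 xsi (ceZ m)).
have V2 := classV_scaled_cond_exp (-1) A0xi0 ceY.
have V3 := classV_decreasing ag gi gint.
(* Coefficients must be nonnegative, so the minus signs sit in the processes: [f = kappa * (Z /
   kappa) + D * (- Y) + (- g)]. *)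
exists 3%N, (fun i : 'I_3 => nth 0%R [:: kappa; D; 1%R] i).
exists (fun i : 'I_3 => nth (fun _ => cst 0%R) [:: (fun m w => 1 * (kappa^-1 * Z m w))%R;
  (fun m w => -1 * Y m w)%R; (fun m w => - g m w)%R] i); split => //.
- by move=> [[|[|[|]]]]//= _; apply: ltW.
- by move=> [[|[|[|]]]]//= _.
- move=> m P MP; apply: aeW => w.
  rewrite !big_ord_recl big_ord0 /= addr0 /Z /N.
  rewrite mul1r mulrA mulfV ?gt_eqF// mul1r mulN1r mulrN mul1r.
  by rewrite addrA addrK addrK.
Qed.

End Necessity.

(** * Equivalence of local regularity and membership in [classK] *)

Unset Implicit Arguments.

Theorem theorem6 (d : measure_display) (T : measurableType d) (R : realType)
    (F : nat -> set (set T)) (M : set (probability T R))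
    (P0 : probability T R) (f : nat -> T -> R) (xi0 : T -> R) (C : R)
    (hF : is_filtration F)
    (hconv : convex_measures M)
    (hequiv : pairwise_equivalent M)
    (hP0 : M P0)
    (hdens : density_condition F M P0)
    (hf : supermartingale F M f)
    (hxi0 : classA0 M xi0)
    (hC : 0 < C)
    (hbound : forall m : nat, (1 <= m)%N ->
       almost_surely M (fun w => `|f m w| <= C * xi0 w)) :
  local_regular F M f <-> classK F M f.
Proof.
split.
- exact: (local_regular_classK hF hequiv hP0 hdens hxi0 hC hbound).
- exact: (classK_local_regular hF hequiv hP0 hdens hf hxi0 hC hbound).
Qed.
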